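(* Let $d\ge 1$ and let $\mathcal T$ be the Terwilliger algebra of $H^*(d,3)$ with respect to the base vertex $(0,\dots,0)$. Under the identification $\mathrm{Mat}_X(\mathbb C)\cong \mathrm{Mat}_3(\mathbb C)^{\otimes d}$ described below, $\mathcal T=\mathrm{Sym}^{(d)}(\mathrm{Mat}_3(\mathbb C))$; in particular $\mathcal T\simeq \mathrm{Sym}^{(d)}(\mathrm{Mat}_3(\mathbb C))$. Moreover $$\mathcal T\simeq \mathrm{Sym}^{(d)}(\mathrm{Mat}_3(\mathbb C))\simeq \bigoplus_{(\ell,m)}\mathrm{Mat}_{n_{\ell,m}}(\mathbb C),$$ where the direct sum runs over all pairs of integers $(\ell,m)$ with $0\le \ell\le \lfloor d/3\rfloor$ and $0\le m\le \lfloor (d-3\ell)/2\rfloor$, and $$n_{\ell,m}=\tfrac12\,(d-3\ell-2m+1)(m+1)(d-3\ell-m+2).$$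
   Context: Let $\mathbb F_3=\{0,1,2\}$ (integers mod 3) and $X=\mathbb F_3^d$. The Hamming digraph $H^*(d,3)$ has vertex set $X$, with an arc from $y$ to $z$ iff $y$ and $z$ differ in exactly one coordinate $i$ and $z_i=y_i+1$ in $\mathbb F_3$. Let $V=\mathbb C^X$ with standard basis $\{\hat y: y\in X\}$, and $\mathrm{Mat}_X(\mathbb C)$ the algebra of complex matrices with rows and columns indexed by $X$. The adjacency matrix $A$ has $(y,z)$-entry $1$ if there is an arc from $y$ to $z$ and $0$ otherwise; $A^\top$ is its transpose. For integers $s,t$, $E^*_{[s,t]}\in \mathrm{Mat}_X(\mathbb C)$ is the diagonal matrix whose $(y,y)$-entry is $1$ if $y$ has exactly $s$ coordinates equal to $1$ and $t$ coordinates equal to $2$, and $0$ otherwise. The Terwilliger algebra $\mathcal T$ is the subalgebra of $\mathrm{Mat}_X(\mathbb C)$ generated by $A$, $A^\top$ and all $E^*_{[s,t]}$. Let $e_0,e_1,e_2$ be the standard basis of $\mathbb C^3$; identify $V$ with $(\mathbb C^3)^{\otimes d}$ via $\hat y\mapsto e_{y_1}\otimes\cdots\otimes e_{y_d}$, which identifies $\mathrm{Mat}_X(\mathbb C)$ with $\mathrm{Mat}_3(\mathbb C)^{\otimes d}$. $\mathrm{Sym}^{(d)}(\mathrm{Mat}_3(\mathbb C))$ denotes the subalgebra of $\mathrm{Mat}_3(\mathbb C)^{\otimes d}$ consisting of the tensors invariant under every permutation of the $d$ tensor factors. *)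

(* Defs.v *)
From HB Require Import structures.
From mathcomp Require Import all_boot all_order all_fingroup all_algebra.
Set Implicit Arguments. Unset Strict Implicit. Unset Printing Implicit Defensive.
Import GRing.Theory.
Local Open Scope ring_scope.

Definition Xd (d : nat) := {ffun 'I_d -> 'Z_3}.

Notation MatX C d := ('M[C]_(#|{: Xd d}|)).

Definition entX (C : Type) (d : nat) (M : MatX C d) (y z : Xd d) : C :=
  M (enum_rank y) (enum_rank z).

Definition mxX (C : Type) (d : nat) (f : Xd d -> Xd d -> C) : MatX C d :=
  \matrix_(i, j) f (enum_val i) (enum_val j).

Definition arc (d : nat) (y z : Xd d) : bool :=
  [exists i : 'I_d, (z i == y i + 1) && [forall j : 'I_d, (j != i) ==> (z j == y j)]].

Definition adjA (C : nzRingType) (d : nat) : MatX C d :=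
  mxX (fun y z => (arc y z)%:R).

Definition cnt (d : nat) (v : 'Z_3) (y : Xd d) : nat := #|[set i : 'I_d | y i == v]|.

Definition Estar (C : nzRingType) (d : nat) (s t : nat) : MatX C d :=
  mxX (fun y z => ((y == z) && (cnt 1 y == s) && (cnt 2 y == t))%:R).

Inductive in_gen_alg (C : nzRingType) (n : nat) (G : 'M[C]_n -> Prop) : 'M[C]_n -> Prop :=
| gen_base M : G M -> in_gen_alg G M
| gen_one : in_gen_alg G 1%:M
| gen_add M N : in_gen_alg G M -> in_gen_alg G N -> in_gen_alg G (M + N)
| gen_scale (c : C) M : in_gen_alg G M -> in_gen_alg G (c *: M)
| gen_mul M N : in_gen_alg G M -> in_gen_alg G N -> in_gen_alg G (M *m N).

Definition terw_gens (C : nzRingType) (d : nat) (M : MatX C d) : Prop :=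
  M = adjA C d \/ M = (adjA C d)^T \/ exists s t : nat, M = Estar C d s t.

Definition Terwilliger (C : nzRingType) (d : nat) : MatX C d -> Prop :=
  in_gen_alg (@terw_gens C d).

(* permutation of the tensor factors = permutation of coordinates *)
Definition permX (d : nat) (s : {perm 'I_d}) (y : Xd d) : Xd d := [ffun i => y (s i)].

(* Sym^(d)(Mat_3(C)) under the identification Mat_X(C) = Mat_3(C)^{(x)d}:
   tensors invariant under every permutation of the d tensor factors. *)
Definition SymX (C : Type) (d : nat) (M : MatX C d) : Prop :=
  forall (s : {perm 'I_d}) (y z : Xd d), entX M (permX s y) (permX s z) = entX M y z.

Definition Idx (d : nat) := {p : nat * nat | (p.1 <= d %/ 3)%N && (p.2 <= (d - 3 * p.1) %/ 2)%N}.

Definition nlm (d l m : nat) : nat :=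
  ((d - 3 * l - 2 * m + 1) * (m + 1) * (d - 3 * l - m + 2)) %/ 2.

Definition nIdx (d : nat) (i : Idx d) : nat := nlm d (sval i).1 (sval i).2.

Definition iso_to_blocks (C : nzRingType) (n : nat) (T : 'M[C]_n -> Prop)
    (I : Type) (k : I -> nat) : Prop :=
  exists f : forall i : I, 'M[C]_n -> 'M[C]_(k i),
    (forall i M N, T M -> T N -> f i (M + N) = f i M + f i N) /\
    (forall i (c : C) M, T M -> f i (c *: M) = c *: f i M) /\
    (forall i M N, T M -> T N -> f i (M *m N) = f i M *m f i N) /\
    (forall i, f i 1%:M = 1%:M) /\
    (forall M N, T M -> T N -> (forall i, f i M = f i N) -> M = N) /\
    (forall B : forall i : I, 'M[C]_(k i), exists2 M, T M & forall i, f i M = B i).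

(* Main.v *)
Require Import Defs.
From mathcomp Require Import all_boot all_order all_fingroup all_algebra.
From mathcomp Require Import zify ring lra.

(* The algebra S = Sym^(d)(Mat_3) acts on row vectors from the right.

   T = S: in characteristic 0, S is generated by the derivations
   Delta x = sum_i 1 (x) .. x .. (x) 1, and commutators of A and of the diagonal
   Delta E_11, Delta E_22 (combinations of the E*_[s,t]) give every Delta E_ab.

   Blocks: for each (l,m) let v be the highest weight vector obtained by
   antisymmetrizing, along the columns of a Young diagram with column lengths
   3^l 2^m 1^(d-3l-2m), the word giving row r the letter r. Antisymmetry along
   columns forces the weight projection E = E*_[wt v] to act on vS as a rank one
   projection onto v, and to kill v'S for all other v' which are not larger in
   dominance order. Since S is closed under adjoints, the elements D E D' realize
   all matrix units on vS, modulo larger weights, so by downward induction S maps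
   onto the product of all End(vS). As dim S = C(d+8,8) = sum n_{l,m}^2, the
   estimate dim vS >= n_{l,m} then gives at once equality and injectivity. That
   estimate is a triangularity argument: the n_{l,m} triples (p,q,r) with
   r <= m, q <= a, p + q <= a + r (a = d-3l-2m) are the leading exponents of the
   products of minors x^i y^j z^k (xz - y)^h of a lower unitriangular matrix. *)

Set Implicit Arguments. Unset Strict Implicit. Unset Printing Implicit Defensive.
Import Order.TTheory GRing.Theory Num.Theory.
Local Open Scope ring_scope.

(* perm.permX and path.arc hide these two names. *)
Local Notation permX := Defs.permX.
Local Notation arc := Defs.arc.

(** * Algebras with highest weight vectors *)

Lemma sum_enum_rank (V : nmodType) (T : finType) (F : 'I_#|T| -> V) :
  \sum_i F i = \sum_t F (enum_rank t).
Proof. by rewrite (reindex _ (onW_bij _ (@enum_rank_bij T))). Qed.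

Section HighestWeight.
Variables (C : fieldType) (n : nat) (S : 'M[C]_n -> Prop).
Variables (T : finType) (D : T -> 'M[C]_n).
Hypothesis S_D : forall t, S (D t).
Hypothesis S_span : forall M, S M -> exists c : T -> C, M = \sum_t c t *: D t.
Hypothesis S_1 : S 1%:M.
Hypothesis S_add : forall M N, S M -> S N -> S (M + N).
Hypothesis S_scale : forall c M, S M -> S (c *: M).
Hypothesis S_mul : forall M N, S M -> S N -> S (M *m N).

Lemma S_sum (J : Type) (r : seq J) (P : pred J) (F : J -> 'M[C]_n) :
  (forall j, P j -> S (F j)) -> S (\sum_(j <- r | P j) F j).
Proof.
move=> SF; apply: (big_ind S) => //.
by rewrite -(scale0r 1%:M); apply: S_scale.
Qed.

Definition cyclicmx (u : 'rV[C]_n) : 'M[C]_(#|T|, n) :=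
  \matrix_t (u *m D (enum_val t)).

Lemma cyclicmxP (u w : 'rV[C]_n) :
  (w <= cyclicmx u)%MS <-> exists2 M, S M & w = u *m M.
Proof.
split=> [/submxP[c ->]|[M /S_span[c ->] ->]].
  exists (\sum_t c 0 (enum_rank t) *: D t).
    by apply: S_sum => t _; apply/S_scale/S_D.
  rewrite mulmx_sum_row mulmx_sumr sum_enum_rank.
  by apply: eq_bigr => t _; rewrite rowK enum_rankK scalemxAr.
rewrite mulmx_sumr; apply: summx_sub => t _; rewrite -scalemxAr scalemx_sub //.
by have := row_sub (enum_rank t) (cyclicmx u); rewrite rowK enum_rankK.
Qed.

Variables (I : finType) (v : I -> 'rV[C]_n) (E : I -> 'M[C]_n).
(** [key] stands in for dominance order: by [E_key], the weight of [i] can occur in [v j S] with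
    [j != i] only if [key i < key j]. The coordinate [x0 i] reads off the multiple of [v i]. *)
Variables (x0 : I -> 'I_n) (key : I -> nat).
Hypothesis S_E : forall i, S (E i).
Hypothesis E_line : forall i M, S M ->
  v i *m M *m E i = (v i *m M) 0 (x0 i) *: v i.
Hypothesis E_key : forall i j M, S M -> j != i -> (key j <= key i)%N ->
  v j *m M *m E i = 0.
Hypothesis nondeg : forall i M, S M -> v i *m M != 0 ->
  exists2 N, S N & (v i *m M *m N) 0 (x0 i) != 0.

Section Bases.
Variables (k : I -> nat) (U : forall i, 'M[C]_(k i, n)).
Hypothesis U_free : forall i, row_free (U i).
Hypothesis U_eq : forall i, (U i == cyclicmx (v i))%MS.

Lemma U_subP i (w : 'rV[C]_n) :
  (w <= U i)%MS <-> exists2 M, S M & w = v i *m M.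
Proof. by rewrite (eqmxP (U_eq i)); apply: cyclicmxP. Qed.

Lemma U_row i (r : 'I_(k i)) : exists2 M, S M & row r (U i) = v i *m M.
Proof. by apply/U_subP/row_sub. Qed.

Lemma U_stable i M : S M -> (U i *m M <= U i)%MS.
Proof.
move=> SM; apply/row_subP => r; rewrite row_mul; apply/U_subP.
have [N SN ->] := U_row r; exists (N *m M); first exact: S_mul.
by rewrite mulmxA.
Qed.

(** By [nondeg], the pairing of [v i S] with [S] through the coordinate [x0 i] has no left kernel,
    so its matrix [G] on [U i] and [D] has a right inverse [Q]; column [r] of [Q] gives the
    coefficients of [N]. *)
Lemma dual_vector i (r : 'I_(k i)) :
  exists2 N, S N & forall q, (U i *m N) q (x0 i) = (q == r)%:R.
Proof.
pose G : 'M_(k i, #|T|) := \matrix_(q, t) (U i *m D (enum_val t)) q (x0 i).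
have /row_freeP[Q GQ]: row_free G.
  apply: inj_row_free => x xG0.
  have /U_subP[M SM xUM]: (x *m U i <= U i)%MS by apply: submxMl.
  have [xU0|] := eqVneq (x *m U i) 0.
    by apply: (row_free_inj (U_free i)); rewrite xU0 mul0mx.
  rewrite xUM => /(nondeg SM)[N /S_span[c ->]] /eqP[].
  rewrite -xUM mulmx_sumr summxE big1 // => t _.
  rewrite -scalemxAr mxE -mulmxA.
  suff ->: (x *m (U i *m D t)) 0 (x0 i) = (x *m G) 0 (enum_rank t).
    by rewrite xG0 mxE mulr0.
  by rewrite !mxE; apply: eq_bigr => q _; rewrite !mxE enum_rankK.
exists (\sum_t Q (enum_rank t) r *: D t).
  by apply: S_sum => t _; apply/S_scale/S_D.
move=> q; have := congr1 (fun A : 'M_(k i) => A q r) GQ; rewrite mxE [RHS]mxE => <-.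
rewrite sum_enum_rank mulmx_sumr summxE; apply: eq_bigr => t _.
by rewrite -scalemxAr [LHS]mxE [G _ _]mxE enum_rankK mulrC.
Qed.

(** In [N r *m E i *m N' r], the factor [N r] extracts the [r]-th coordinate, [E i] collapses the
    result onto [v i], and [N' r] sends [v i] to row [r] of [B *m U i]. *)
Lemma triangular_unit i (B : 'M[C]_(k i)) :
  exists2 M, S M & U i *m M = B *m U i /\
    forall j, j != i -> (key j <= key i)%N -> U j *m M = 0.
Proof.
have /fin_all_exists2[N SN NE] := @dual_vector i.
have /fin_all_exists2[N' SN' N'E]: forall r, exists2 M, S M & row r (B *m U i) = v i *m M.
  move=> r; apply/U_subP; apply: submx_trans (row_sub _ _) (submxMl _ _).
exists (\sum_r N r *m E i *m N' r).
  by apply: S_sum => r _; apply: S_mul => //; apply: S_mul.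
split.
  apply/row_matrixP => q; rewrite N'E row_mul mulmx_sumr (bigD1 q) //= big1 => [|r].
    rewrite addr0; have [M SM Mq] := U_row q.
    rewrite !mulmxA Mq -(mulmxA (v i)) E_line; last exact: S_mul.
    by rewrite mulmxA -Mq -row_mul mxE NE eqxx scale1r.
  rewrite eq_sym => qr; have [M SM Mq] := U_row q.
  rewrite !mulmxA Mq -(mulmxA (v i)) E_line; last exact: S_mul.
  by rewrite mulmxA -Mq -row_mul mxE NE (negPf qr) scale0r mul0mx.
move=> j ji kji; apply/row_matrixP => q; rewrite row0 row_mul.
have [M SM ->] := U_row q.
rewrite mulmx_sumr big1 // => r _.
by rewrite !mulmxA -(mulmxA (v j)) E_key ?mul0mx //; apply: S_mul.
Qed.

(** Downward induction on [key]: a triangular unit may still act on blocks of larger key, and the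
    induction hypothesis supplies elements [R j] that reproduce this action on block [j] alone and
    are subtracted. *)
Lemma block_unit i (B : 'M[C]_(k i)) :
  exists2 M, S M & U i *m M = B *m U i /\ forall j, j != i -> U j *m M = 0.
Proof.
pose K := \max_j key j.
have [e lt_e] := ubnP (K - key i)%N; elim: e i B lt_e => // e IH i B lt_e.
have [M SM [MB M0]] := triangular_unit B.
have /fin_all_exists2[R SR RE] : forall j, exists2 R, S R &
    if (key i < key j)%N then U j *m R = U j *m M /\ forall j', j' != j -> U j' *m R = 0
    else R = 0.
  move=> j; case: (ltnP (key i) (key j)) => [kij|_]; last first.
    by exists 0 => //; rewrite -(scale0r 1%:M); apply: S_scale.
  have /submxP[B' ->] := U_stable j SM.
  have kjK : (key j <= K)%N by apply: leq_bigmax.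
  have [|R SR RE] := IH j B'; last by exists R.
  by lia.
have RE' j j' : j' != j -> U j' *m R j = 0.
  move=> jj'; have := RE j; case: ifP => [_ [_ ->] //|_ ->].
  by rewrite mulmx0.
exists (M - \sum_j R j).
  apply: S_add => //; rewrite -scaleN1r; apply: S_scale.
  by apply: S_sum.
have UE j : U j *m (M - \sum_j R j) = U j *m M - U j *m R j.
  rewrite mulmxBr mulmx_sumr (bigD1 j) //= [X in _ - (_ + X)]big1 ?addr0 // => j' jj'.
  by rewrite RE' // eq_sym.
split; first by rewrite UE MB; have := RE i; rewrite ltnn => ->; rewrite mulmx0 subr0.
move=> j ji; rewrite UE; have := RE j; case: ltnP => [_ [-> _]|kji ->].
  by rewrite subrr.
by rewrite M0 // mulmx0 subr0.
Qed.

Let X := {i : I & ('I_(k i) * 'I_(k i))%type}.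

Lemma card_unit_index : #|{: X}| = (\sum_i k i ^ 2)%N.
Proof.
rewrite card_tagged sumnE big_map big_enum /=.
by apply: eq_bigr => i _; rewrite card_prod card_ord mulnn.
Qed.

(* The coefficients on [D] of matrix units of all blocks form a row-free
   matrix; when it is square the units span [S]. *)
Lemma unit_coefs : exists2 G : 'M[C]_(#|{: X}|, #|T|), row_free G &
  forall x : 'rV_#|{: X}|, (forall i, U i *m (\sum_t (x *m G) 0 (enum_rank t) *: D t) = 0) -> x = 0.
Proof.
have /fin_all_exists2[B SB BE]: forall b : X, exists2 M, S M &
    U (tag b) *m M = delta_mx (tagged b).1 (tagged b).2 *m U (tag b) /\
    forall j, j != tag b -> U j *m M = 0.
  by move=> [i [r s]] /=; apply: block_unit.
have /fin_all_exists[c cE] : forall b : X, exists c : T -> C, B b = \sum_t c t *: D t.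
  by move=> b; apply: S_span.
pose G : 'M_(#|{: X}|, #|T|) := \matrix_(b, t) c (enum_val b) (enum_val t).
have GE (x : 'rV_#|{: X}|) :
    \sum_t (x *m G) 0 (enum_rank t) *: D t = \sum_b x 0 (enum_rank b) *: B b.
  transitivity (\sum_t \sum_b x 0 (enum_rank b) *: (c b t *: D t)).
    apply: eq_bigr => t _; rewrite mxE sum_enum_rank scaler_suml.
    by apply: eq_bigr => b _; rewrite mxE !enum_rankK scalerA.
  by rewrite exchange_big; apply: eq_bigr => b _; rewrite -scaler_sumr -cE.
have inj (x : 'rV_#|{: X}|) :
    (forall i, U i *m (\sum_t (x *m G) 0 (enum_rank t) *: D t) = 0) -> x = 0.
  move=> x0_; apply/rowP => b0; rewrite mxE; rewrite -[b0]enum_valK.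
  case: (enum_val b0) => i [r s].
  have := x0_ i; rewrite GE mulmx_sumr => UB0.
  pose Y : 'M_(k i) := \matrix_(r, s) x 0 (enum_rank (Tagged _ (r, s) : X)).
  suff : Y *m U i = 0 *m U i.
    by move/(row_free_inj (U_free i))/matrixP/(_ r s); rewrite !mxE.
  rewrite mul0mx -{}UB0 [Y]matrix_sum_delta.
  rewrite pair_big /= mulmx_suml.
  pose tg j (p : 'I_(k j) * 'I_(k j)) : X := existT _ j p.
  pose F j p : 'M_(k i, n) := U i *m (x 0 (enum_rank (tg j p)) *: B (tg j p)).
  transitivity (\sum_(b : X) F (tag b) (tagged b)); last by apply: eq_bigr => -[].
  have <- := @sig_big_dep _ 0 +%R I _ xpredT (fun _ => xpredT) F.
  rewrite (bigD1 i) //=.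
  rewrite [X in _ = _ + X]big1 ?addr0 => [|j ji].
    apply: eq_bigr => p _; rewrite mxE /F -scalemxAl -scalemxAr.
    by have [-> _] := BE (tg i p); rewrite -surjective_pairing.
  rewrite big1 // => p _; rewrite /F -scalemxAr.
  by rewrite (BE (tg _ p)).2 ?scaler0 //= eq_sym.
exists G => //; apply: inj_row_free => x xG; apply: inj => i.
by rewrite big1 ?mulmx0 // => t _; rewrite xG mxE scale0r.
Qed.

Lemma sum_block_leq : (\sum_i k i ^ 2 <= #|T|)%N.
Proof.
have [G /eqP Gfree _] := unit_coefs.
by rewrite -card_unit_index -Gfree rank_leq_col.
Qed.

(** In the equality case the coefficient matrix of the units is square, so every element of [S] is a
    combination of units, and one that acts as zero on all blocks is trivial. *)
Lemma faithful_blocks M : (\sum_i k i ^ 2 = #|T|)%N -> S M ->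
  (forall i, U i *m M = 0) -> M = 0.
Proof.
move=> cardT /S_span[c ->]; have [G Gfree inj] := unit_coefs.
have Gfull : row_full G by rewrite /row_full (eqP Gfree) card_unit_index cardT.
have /submxP[x cE] : (\row_t c (enum_val t) <= G)%MS by apply: submx_full.
have cxE t : c t = (x *m G) 0 (enum_rank t) by rewrite -cE mxE enum_rankK.
rewrite (eq_bigr (fun t => (x *m G) 0 (enum_rank t) *: D t)); last by move=> t _; rewrite cxE.
move=> /inj->; rewrite big1 // => t _.
by rewrite mul0mx mxE scale0r.
Qed.

Lemma iso_blocks_bases : (\sum_i k i ^ 2 = #|T|)%N -> iso_to_blocks S k.
Proof.
(* The matrix, in the basis [U i], of the right action of [M] on [v i S]. *)
move=> cardT; exists (fun i M => U i *m M *m pinvmx (U i)).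
have UK i : U i *m pinvmx (U i) = 1%:M by apply: mulmxVp.
have fE i M : S M -> U i *m M = U i *m M *m pinvmx (U i) *m U i.
  by move=> SM; rewrite mulmxKpV // U_stable.
split; [|split; [|split; [|split; [|split]]]].
- by move=> i M N _ _; rewrite mulmxDr mulmxDl.
- by move=> i c M _; rewrite -scalemxAr -scalemxAl.
- by move=> i M N SM SN; rewrite (mulmxA (U i) M) [in LHS](fE i M) // !mulmxA.
- by move=> i; rewrite mulmx1 UK.
- move=> M N SM SN fMN; apply: subr0_eq.
  apply: faithful_blocks => // [|i].
    by apply: S_add => //; rewrite -scaleN1r; apply: S_scale.
  by rewrite mulmxBr (fE i M) // fMN -fE // subrr.
move=> B; have /fin_all_exists2[M SM ME] := fun i => block_unit (B i).
exists (\sum_i M i) => [|i]; first exact: S_sum.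
rewrite mulmx_sumr (bigD1 i) //= big1 ?addr0 => [|j ji]; last by rewrite (ME j).2 // eq_sym.
by rewrite (ME i).1 -mulmxA UK mulmx1.
Qed.

End Bases.

(** The squares of the ranks sum to at most [#|T|], which is already the sum of the [k i ^ 2]; hence
    no rank can exceed its lower bound [k i]. *)
Lemma iso_blocks_highest_weight (k : I -> nat) :
  (forall i, k i <= \rank (cyclicmx (v i)))%N -> (\sum_i k i ^ 2 = #|T|)%N ->
  iso_to_blocks S k.
Proof.
move=> le_k cardT.
(* The rank is generalized to [m] so that [k i] can replace it in the type of [U]. *)
have basis (i : I) (m : nat) : \rank (cyclicmx (v i)) = m ->
    exists2 U : 'M[C]_(m, n), row_free U & (U == cyclicmx (v i))%MS.
  by move=> <-; exists (row_base (cyclicmx (v i))); [apply: row_base_free|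
    apply/eqmxP/eq_row_base].
have rk_k i : \rank (cyclicmx (v i)) = k i.
  have /fin_all_exists2[U Uf UE] := fun i => basis i _ erefl.
  have le_sum := leq_trans (sum_block_leq Uf UE) (eq_leq (esym cardT)).
  apply/eqP; rewrite eqn_leq le_k andbT leqNgt; apply/negP => lt_k.
  move: le_sum; rewrite leqNgt => /negP[].
  rewrite (bigD1 i) // [X in (_ < X)%N](bigD1 i) //=.
  rewrite -addSn leq_add ?ltn_sqr //.
  by apply: leq_sum => j _; rewrite leq_sqr.
have /fin_all_exists2[U Uf UE] := fun i => basis i _ (rk_k i).
exact: (iso_blocks_bases Uf UE).
Qed.

End HighestWeight.

(** * Symmetric tensors and their orbit basis *)

Section MatX.
Variables (C : comNzRingType) (d : nat).
Implicit Types (M N : MatX C d) (y z : Xd d) (s : {perm 'I_d}).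

Lemma entX_mxX f y z : entX (mxX f : MatX C d) y z = f y z.
Proof. by rewrite /entX mxE !enum_rankK. Qed.

Lemma entX_inj M N : (forall y z, entX M y z = entX N y z) -> M = N.
Proof.
move=> eqMN; apply/matrixP => i j.
by have := eqMN (enum_val i) (enum_val j); rewrite /entX !enum_valK.
Qed.

Lemma entX_mul M N y z : entX (M *m N) y z = \sum_x entX M y x * entX N x z.
Proof. by rewrite /entX mxE sum_enum_rank. Qed.

Lemma entXD M N y z : entX (M + N) y z = entX M y z + entX N y z.
Proof. by rewrite /entX mxE. Qed.

Lemma entXZ c M y z : entX (c *: M) y z = c * entX M y z.
Proof. by rewrite /entX mxE. Qed.

Lemma entX_sum (J : Type) (r : seq J) (P : pred J) (F : J -> MatX C d) y z :
  entX (\sum_(j <- r | P j) F j) y z = \sum_(j <- r | P j) entX (F j) y z.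
Proof. by rewrite /entX summxE. Qed.

Lemma entX1 y z : entX (1%:M : MatX C d) y z = (y == z)%:R.
Proof. by rewrite /entX mxE (inj_eq enum_rank_inj). Qed.

Lemma permX1 y : permX 1 y = y.
Proof. by apply/ffunP => i; rewrite ffunE perm1. Qed.

Lemma permXM s t y : permX s (permX t y) = permX (s * t) y.
Proof. by apply/ffunP => i; rewrite !ffunE permM. Qed.

Lemma permXK s : cancel (permX s) (permX s^-1).
Proof. by move=> y; rewrite permXM mulVg permX1. Qed.

Lemma permXVK s : cancel (permX s^-1) (permX s).
Proof. by move=> y; rewrite permXM mulgV permX1. Qed.

Lemma permX_inj s : injective (permX s).
Proof. exact: can_inj (permXK s). Qed.

Lemma reindex_permX (V : nmodType) s (F : Xd d -> V) :
  \sum_y F y = \sum_y F (permX s y).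
Proof. exact: (reindex_inj (@permX_inj s)). Qed.

Lemma SymX1 : SymX (1%:M : MatX C d).
Proof. by move=> s y z; rewrite !entX1 (inj_eq (@permX_inj s)). Qed.

Lemma SymXD M N : SymX M -> SymX N -> SymX (M + N).
Proof. by move=> SM SN s y z; rewrite !entXD SM SN. Qed.

Lemma SymXZ c M : SymX M -> SymX (c *: M).
Proof. by move=> SM s y z; rewrite !entXZ SM. Qed.

Lemma SymX_mul M N : SymX M -> SymX N -> SymX (M *m N).
Proof.
move=> SM SN s y z; rewrite !entX_mul (reindex_permX s).
by apply: eq_bigr => x _; rewrite SM SN.
Qed.

Lemma SymX_tr M : SymX M -> SymX M^T.
Proof.
by move=> SM s y z; have := SM s z y; rewrite /entX !mxE.
Qed.

Lemma SymX_mxX f : (forall s y z, f (permX s y) (permX s z) = f y z) ->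
  SymX (mxX f : MatX C d).
Proof. by move=> fs s y z; rewrite !entX_mxX. Qed.

Lemma card_permX s (P : pred 'I_d) : #|[set i | P (s i)]| = #|[set i | P i]|.
Proof.
rewrite -(card_imset [set i | P (s i)] (@perm_inj _ s)).
apply: eq_card => i; rewrite inE; apply/imsetP/idP => [[j]|Pi].
  by rewrite inE => Pj ->.
by exists ((s^-1)%g i); rewrite ?inE permKV.
Qed.

Lemma cnt_permX v s y : cnt v (permX s y) = cnt v y.
Proof.
rewrite -[RHS](card_permX s (fun i => y i == v)).
by apply: eq_card => i; rewrite !inE ffunE.
Qed.

Lemma SymX_Estar (k l : nat) : SymX (Estar C d k l).
Proof.
by apply: SymX_mxX => p y z; rewrite !cnt_permX (inj_eq (@permX_inj p)).
Qed.

Lemma SymX_adjA : SymX (adjA C d).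
Proof.
have arcP s y z : arc y z -> arc (permX s y) (permX s z).
  move=> /existsP[i /andP[zi /forallP yz]]; apply/existsP; exists (s^-1 i)%g.
  rewrite !ffunE permKV zi; apply/forallP => j; rewrite !ffunE.
  by apply/implyP => ji; apply: (implyP (yz _)); rewrite -(inj_eq (@perm_inj _ s^-1%g)) permK.
apply: SymX_mxX => s y z; congr (_ %:R); congr nat_of_bool.
by apply/idP/idP => [/(arcP s^-1%g)|/arcP//]; rewrite !permXK.
Qed.

Lemma Terwilliger_SymX M : Terwilliger M -> SymX M.
Proof.
elim=> [{}M [->|[->|[s [t ->]]]]|| {}M N _ SM _ SN | c {}M _ SM | {}M N _ SM _ SN].
- exact: SymX_adjA.
- exact/SymX_tr/SymX_adjA.
- exact: SymX_Estar.
- exact: SymX1.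
- exact: SymXD.
- exact: SymXZ.
- exact: SymX_mul.
Qed.

Definition pair_code (a b : 'Z_3) : 'I_9 := inord (3 * a + b).

Lemma pair_code_inj a b a' b' :
  pair_code a b = pair_code a' b' -> a = a' /\ b = b'.
Proof.
have lt3 (x : 'Z_3) : (x < 3)%N := ltn_ord x.
move: (lt3 a) (lt3 b) (lt3 a') (lt3 b') => a3 b3 a'3 b'3.
move=> /(congr1 val); rewrite /= !inordK; try lia.
by move=> E; split; apply: val_inj => /=; lia.
Qed.

(** A complete invariant for orbits of pairs under simultaneous permutation of places. Counts are at
    most [d], so [inord] is faithful, and the type is that of [card_ord_partitions]. *)
Definition pair_type y z : 9.-tuple 'I_d.+1 :=
  [tuple inord #|[set i | pair_code (y i) (z i) == k]| | k < 9].

Lemma tnth_pair_type y z k :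
  tnth (pair_type y z) k = #|[set i | pair_code (y i) (z i) == k]| :> nat.
Proof.
by rewrite tnth_mktuple inordK // ltnS (leq_trans (max_card _)) ?card_ord.
Qed.

Definition is_pair_type (t : 9.-tuple 'I_d.+1) := (\sum_(i <- t) i == d)%N.

Lemma pair_type_sum y z : is_pair_type (pair_type y z).
Proof.
rewrite /is_pair_type big_tuple; apply/eqP.
under eq_bigr do rewrite tnth_pair_type -sum1dep_card.
by rewrite -[RHS]card_ord -sum1_card (partition_big (fun i => pair_code (y i) (z i)) xpredT).
Qed.

Definition orbit_mx (t : {t : 9.-tuple 'I_d.+1 | is_pair_type t}) : MatX C d :=
  mxX (fun y z => (pair_type y z == val t)%:R).

Lemma card_pair_type : #|{: {t : 9.-tuple 'I_d.+1 | is_pair_type t}}| = 'C(d + 8, 8).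
Proof.
rewrite card_sig addnC -card_ord_partitions.
by apply: eq_card => t; rewrite inE.
Qed.

Lemma pair_type_permX s y z : pair_type (permX s y) (permX s z) = pair_type y z.
Proof.
apply: eq_from_tnth => k; apply: val_inj; rewrite /= !tnth_pair_type.
rewrite -[RHS](card_permX s (fun i => pair_code (y i) (z i) == k)).
by apply: eq_card => i; rewrite !inE !ffunE.
Qed.

Lemma SymX_orbit_mx t : SymX (orbit_mx t).
Proof. by apply: SymX_mxX => s y z; rewrite pair_type_permX. Qed.

(** Equal counts make the two words of pair codes rearrangements of each other, and the rearranging
    permutation acts on both components at once. *)
Lemma pair_type_orbit y z y' z' : pair_type y z = pair_type y' z' ->
  exists s, y' = permX s y /\ z' = permX s z.
Proof.
move=> eq_t; pose c y z := [tuple pair_code (y i) (z i) | i < d] : d.-tuple 'I_9.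
have /tuple_permP[s cE]: perm_eq (c y' z') (c y z).
  apply/seq.permP => P.
  suff cnt_c k : count_mem k (c y' z') = count_mem k (c y z).
    by apply/seq.permP: P; rewrite /perm_eq; apply/allP => k _ /=; rewrite cnt_c.
  have cntE x w : count_mem k (c x w) = tnth (pair_type x w) k.
    rewrite tnth_pair_type -sum1_count big_tuple -sum1dep_card.
    by apply: eq_bigl => i; rewrite tnth_mktuple.
  by rewrite !cntE eq_t.
have codeE i : pair_code (y' i) (z' i) = pair_code (y (s i)) (z (s i)).
  by have := congr1 (fun t : seq 'I_9 => nth ord0 t i) cE; rewrite -!tnth_nth !tnth_mktuple.
by exists s; split; apply/ffunP => i; rewrite ffunE; have [] := pair_code_inj (codeE i).
Qed.

Lemma SymX_span M : SymX M -> exists c, M = \sum_t c t *: orbit_mx t.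
Proof.
move=> SM.
pose rep (t : {t : 9.-tuple 'I_d.+1 | is_pair_type t}) :=
  [pick yz : Xd d * Xd d | pair_type yz.1 yz.2 == val t].
(* The entry of [M] at any pair of the orbit; the default 0 concerns only types that no pair
   realizes. *)
exists (fun t => if rep t is Some yz then entX M yz.1 yz.2 else 0).
apply: entX_inj => y z; rewrite entX_sum.
rewrite (bigD1 (exist _ (pair_type y z) (pair_type_sum y z))) //= big1 => [|t ty].
  rewrite addr0 entXZ entX_mxX eqxx mulr1 /rep.
  case: pickP => [[y' z'] /= /eqP/pair_type_orbit[s [-> ->]]|/(_ (y, z))/=]; last by rewrite eqxx.
  by rewrite SM.
rewrite entXZ entX_mxX; case: eqP => [E|_]; last by rewrite mulr0.
by case/eqP: ty; apply: val_inj.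
Qed.

End MatX.

(** * Symmetric tensors lie in the Terwilliger algebra *)

Section Tensors.
Variables (C : numFieldType) (d : nat).
Implicit Types (G H : {ffun 'I_d -> 'M[C]_3}) (x : 'M[C]_3) (s : {perm 'I_d}).

Definition tens G : MatX C d := mxX (fun y z => \prod_i G i (y i) (z i)).

Definition upd G j x : {ffun 'I_d -> 'M[C]_3} := [ffun i => if i == j then x else G i].

Definition symtens G : MatX C d := \sum_(s : {perm 'I_d}) tens [ffun i => G (s i)].

Definition place j x : MatX C d := tens (upd [ffun=> 1%:M] j x).

Definition Delta x : MatX C d := \sum_j place j x.

Lemma tens_mul G H : tens G *m tens H = tens [ffun i => G i *m H i].
Proof.
apply: entX_inj => y z; rewrite entX_mul entX_mxX.
under [RHS]eq_bigr do rewrite ffunE mxE.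
rewrite (bigA_distr_bigA (fun i a => G i (y i) a * H i a (z i))) /=.
by apply: eq_bigr => w _; rewrite !entX_mxX -big_split.
Qed.

Lemma tens1 : tens [ffun=> 1%:M] = 1%:M.
Proof.
apply: entX_inj => y z; rewrite entX1 entX_mxX.
under eq_bigr do rewrite ffunE mxE.
have [->|neq] := eqVneq y z; first by rewrite big1 // => i _; rewrite eqxx.
case: (pickP (fun i => y i != z i)) => [i yzi|yz].
  by rewrite (bigD1 i) //= (negPf yzi) mul0r.
by case/eqP: neq; apply/ffunP => i; apply/eqP; have := yz i; rewrite /= => /negbFE.
Qed.

Lemma entX_place j x y z :
  entX (place j x) y z = x (y j) (z j) * \prod_(i | i != j) (y i == z i)%:R.
Proof.
rewrite entX_mxX (bigD1 j) //= ffunE eqxx; congr (_ * _).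
by apply: eq_bigr => i /negPf ij; rewrite !ffunE ij mxE.
Qed.

Lemma place_mul j x1 x2 : place j x1 *m place j x2 = place j (x1 *m x2).
Proof.
rewrite tens_mul; congr tens; apply/ffunP => i; rewrite !ffunE.
by case: eqP => // _; rewrite mulmx1.
Qed.

Lemma place_comm j k x1 x2 : j != k ->
  place j x1 *m place k x2 = place k x2 *m place j x1.
Proof.
move=> jk; rewrite !tens_mul; congr tens; apply/ffunP => i; rewrite !ffunE.
have [->|_] := eqVneq i j; first by rewrite (negPf jk) mulmx1 mul1mx.
by case: eqP => _; rewrite ?mulmx1 ?mul1mx.
Qed.

Lemma DeltaD x1 x2 : Delta (x1 + x2) = Delta x1 + Delta x2.
Proof.
rewrite /Delta -big_split; apply: eq_bigr => j _; apply: entX_inj => y z /=.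
by rewrite entXD !entX_place mxE mulrDl.
Qed.

Lemma DeltaZ c x : Delta (c *: x) = c *: Delta x.
Proof.
rewrite /Delta scaler_sumr; apply: eq_bigr => j _; apply: entX_inj => y z /=.
by rewrite entXZ !entX_place mxE mulrA.
Qed.

(** Factors at different places commute, so the off-diagonal terms of the two products cancel. *)
Lemma Delta_comm x1 x2 :
  Delta x1 *m Delta x2 - Delta x2 *m Delta x1 = Delta (x1 *m x2 - x2 *m x1).
Proof.
have DeltaE x3 x4 : Delta x3 *m Delta x4 =
    Delta (x3 *m x4) + \sum_j \sum_(k | k != j) place j x3 *m place k x4.
  rewrite mulmx_suml -big_split; apply: eq_bigr => j _ /=.
  by rewrite mulmx_sumr (bigD1 j) //= place_mul.
have -> : x1 *m x2 - x2 *m x1 = x1 *m x2 + (-1) *: (x2 *m x1) by rewrite scaleN1r.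
rewrite DeltaD DeltaZ scaleN1r !DeltaE.
rewrite [X in _ - (_ + X)](exchange_big_dep xpredT) //=.
set u := \sum_j _; set w := \sum_j _.
suff -> : w = u by rewrite opprD addrACA subrr addr0.
apply: eq_bigr => j _; apply: eq_big => [k|k jk]; first by rewrite eq_sym.
by rewrite place_comm // eq_sym.
Qed.

Lemma symtens_mul_Delta G x :
  symtens G *m Delta x = \sum_k symtens (upd G k (G k *m x)).
Proof.
rewrite mulmx_suml exchange_big; apply: eq_bigr => s _ /=.
rewrite mulmx_sumr [RHS](reindex_inj (@perm_inj _ s)); apply: eq_bigr => j _ /=.
rewrite tens_mul; congr tens; apply/ffunP => i; rewrite !ffunE.
by rewrite (inj_eq perm_inj); case: eqP => [->|] //; rewrite mulmx1.
Qed.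

Lemma symtens_perm G (t : {perm 'I_d}) : symtens [ffun i => G (t i)] = symtens G.
Proof.
rewrite [RHS](reindex_inj (mulIg t)); apply: eq_bigr => s _ /=.
by congr tens; apply/ffunP => i; rewrite !ffunE permM.
Qed.

Variable P : MatX C d -> Prop.
Hypothesis P_1 : P 1%:M.
Hypothesis P_add : forall M N, P M -> P N -> P (M + N).
Hypothesis P_scale : forall c M, P M -> P (c *: M).
Hypothesis P_mul : forall M N, P M -> P N -> P (M *m N).

Lemma closed0 : P 0.
Proof. by rewrite -(scale0r 1%:M); apply: P_scale. Qed.

Lemma closedB M N : P M -> P N -> P (M - N).
Proof. by move=> PM PN; apply: P_add => //; rewrite -scaleN1r; apply: P_scale. Qed.

Lemma closed_sum (J : Type) (r : seq J) (Q : pred J) (F : J -> MatX C d) :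
  (forall j, Q j -> P (F j)) -> P (\sum_(j <- r | Q j) F j).
Proof. by move=> PF; apply: (big_ind P) => //; apply: closed0. Qed.

Lemma closed_unscale (m : nat) M : (0 < m)%N -> P (m%:R *: M) -> P M.
Proof.
move=> m0 /(P_scale m%:R^-1); rewrite scalerA mulVf ?scale1r //.
by rewrite pnatr_eq0 -lt0n.
Qed.

(* Induction on the number of factors [G i] other than the identity: moving one
   of them, [G k], out of [G] into a right factor [Delta (G k)] gives back
   [#|J| symtens G], up to terms with fewer such factors. *)
Lemma closed_symtens : (forall x, P (Delta x)) -> forall G, P (symtens G).
Proof.
move=> PD G; have [e lt_e] := ubnP #|[set i | G i != 1%:M]|.
elim: e G lt_e => // e IH G lt_e.
have [/eqP|[k]] := set_0Vmem [set i | G i != 1%:M].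
  rewrite -subset0 => /subsetP G1; apply: closed_sum => s _.
  suff -> : [ffun i => G (s i)] = [ffun=> 1%:M] by rewrite tens1.
  apply/ffunP => i; rewrite !ffunE; have := G1 (s i).
  by rewrite !inE; case: eqP => // _ /(_ isT).
rewrite inE => Gk; pose G' := upd G k 1%:M; pose J := [set j | G' j == 1%:M].
have kJ : k \in J by rewrite inE ffunE eqxx.
have supp_lt : (#|~: J| < e)%N.
  rewrite -ltnS (leq_trans _ lt_e) // ltnS; apply: proper_card.
  apply/properP; split; last by exists k; rewrite ?inE ?ffunE ?eqxx.
  by apply/subsetP => i; rewrite !inE ffunE; case: (i =P k) => //; rewrite eqxx.
apply: (@closed_unscale #|J|); first by apply/card_gt0P; exists k.
have -> : #|J|%:R *: symtens G = symtens G' *m Delta (G k)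
    - \sum_(j in ~: J) symtens (upd G' j (G' j *m G k)).
  rewrite symtens_mul_Delta (bigID (mem J)) /=.
  rewrite [X in _ + X - _](eq_bigl (mem (~: J))) => [|j]; last by rewrite !inE.
  rewrite addrK (eq_bigr (fun=> symtens G)) => [|j jJ].
    by rewrite sumr_const scaler_nat.
  (* For [j] in [J] the factor of [G'] at [j] is the identity, so [G k] lands there; transposing [j]
     and [k] recovers [G]. *)
  rewrite -[RHS](symtens_perm G (tperm j k)); congr symtens; apply/ffunP => i.
  move: jJ; rewrite !inE !ffunE => /eqP G'j.
  case: tpermP => [->|->|]; first by rewrite eqxx G'j mul1mx.
    rewrite eqxx; case: (k =P j) => [kj|/eqP/negPf kj]; first by rewrite G'j mul1mx kj.
    by rewrite eq_sym kj in G'j; rewrite G'j.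
  by move=> /eqP/negPf-> /eqP/negPf->.
have suppG' : [set i | G' i != 1%:M] = ~: J by apply/setP => i; rewrite !inE.
apply: closedB; first by apply: P_mul => //; apply: IH; rewrite suppG'.
apply: closed_sum => j jJ; apply: IH.
apply: leq_ltn_trans supp_lt; apply: subset_leq_card; apply/subsetP => i.
by move: jJ; rewrite !inE !ffunE; case: (i =P j) => // ->.
Qed.

(** Symmetrizing the expansion of [M] in tensors of matrix units multiplies the invariant [M] by the
    number of permutations, which is invertible in characteristic 0. *)
Lemma closed_SymX : (forall x, P (Delta x)) -> forall M, SymX M -> P M.
Proof.
move=> PD M SM; apply: (@closed_unscale #|{perm 'I_d}|).
  by rewrite card_Sn fact_gt0.
suff -> : #|{perm 'I_d}|%:R *: M = \sum_y \sum_z entX M y z *: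
    symtens [ffun i => delta_mx (y i : 'I_3) (z i : 'I_3)].
  by do 2![apply: closed_sum => ? _]; apply/P_scale/closed_symtens.
apply: entX_inj => y' z'; rewrite entXZ -sum1_card natr_sum mulr_suml.
rewrite entX_sum.
transitivity (\sum_y \sum_z \sum_(s : {perm 'I_d})
    entX M y z * ((y' == permX s y) && (z' == permX s z))%:R).
  under [RHS]eq_bigr do rewrite exchange_big.
  rewrite exchange_big; apply: eq_bigr => s _ /=.
  rewrite (bigD1 (permX s^-1 y')) //= [X in _ + X]big1 ?addr0 => [|y yy]; last first.
    rewrite big1 // => z _; case: eqP => [E|]; last by rewrite mulr0.
    by rewrite E permXK eqxx in yy.
  rewrite (bigD1 (permX s^-1 z')) //= [X in _ + X]big1 ?addr0 => [|z zz]; last first.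
    case: (z' =P _) => [E|]; last by rewrite andbF mulr0.
    by rewrite E permXK eqxx in zz.
  by rewrite !permXVK !eqxx SM mulr1 mul1r.
apply: eq_bigr => y _; rewrite entX_sum; apply: eq_bigr => z _.
rewrite entXZ entX_sum -mulr_sumr; congr (_ * _); apply: eq_bigr => s _.
rewrite entX_mxX.
have prodE (p : pred 'I_d) : \prod_i (p i)%:R = [forall i, p i]%:R :> C.
  case: forallP => [h|/forallP]; first by rewrite big1 // => i _; rewrite h.
  by rewrite negb_forall => /existsP[i /negPf pi]; rewrite (bigD1 i) //= pi mul0r.
rewrite (eq_bigr (fun i => ((y' i == y (s i)) && (z' i == z (s i)))%:R)) => [|i _]; last first.
  by rewrite !ffunE mxE.
rewrite prodE; congr (_ %:R); congr nat_of_bool; apply/andP/forallP => [[/eqP-> /eqP->] i|h].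
  by rewrite !ffunE !eqxx.
by split; apply/eqP/ffunP => i; rewrite ffunE; have /andP[/eqP ? /eqP] := h i.
Qed.

End Tensors.

(** * Derivations in the Terwilliger algebra *)

Section TerwilligerTensors.
Variables (C : numFieldType) (d : nat).

Lemma prod_eq_diag (j : 'I_d) (y z : Xd d) :
  \prod_(i | i != j) (y i == z i)%:R = [forall i, (i != j) ==> (y i == z i)]%:R :> C.
Proof.
case: forallP => [h|/forallP].
  by rewrite big1 // => i ij; rewrite (implyP (h i)).
rewrite negb_forall => /existsP[i]; rewrite negb_imply => /andP[ij /negPf yz].
by rewrite (bigD1 i) //= yz mul0r.
Qed.

Lemma entX_Delta_diag (a : 'Z_3) (y z : Xd d) :
  entX (Delta d (delta_mx a a : 'M[C]_3)) y z = (y == z)%:R * (cnt a y)%:R.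
Proof.
rewrite entX_sum /cnt -sum1dep_card natr_sum mulr_sumr [RHS]big_mkcond /=.
apply: eq_bigr => j _; rewrite entX_place mxE prod_eq_diag -natrM mulnb.
have [->|neq] := eqVneq y z.
  have -> : [forall i, (i != j) ==> (z i == z i)] by apply/forallP => i; rewrite eqxx implybT.
  by rewrite andbb andbT mul1r; case: eqP.
rewrite mul0r if_same; case: andP => // -[/andP[/eqP yj /eqP zj] /forallP h].
case/eqP: neq; apply/ffunP => i; have [->|ij] := eqVneq i j; first by rewrite yj zj.
by apply/eqP/(implyP (h i)).
Qed.

Lemma adjA_Delta : adjA C d = Delta d (\matrix_(a < 3, b < 3) ((b : 'Z_3) == (a : 'Z_3) + 1)%:R).
Proof.
apply: entX_inj => y z; rewrite entX_mxX entX_sum /Defs.arc.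
have placeE j : entX (place j (\matrix_(a < 3, b < 3) ((b : 'Z_3) == (a : 'Z_3) + 1)%:R)) y z
    = ((z j == y j + 1) && [forall i, (i != j) ==> (z i == y i)])%:R :> C.
  rewrite entX_place mxE prod_eq_diag -natrM mulnb; congr (_ %:R); congr (nat_of_bool (_ && _)).
  by apply: eq_forallb => i; rewrite [y i == _]eq_sym.
case: existsP => [[i arci]|noarc]; last first.
  by rewrite big1 // => j _; rewrite placeE; case: andP => // /andP h; case: noarc; exists j.
(* Only the place [i] of the arc contributes: any other would force [z i = y i], against
   [z i = y i + 1]. *)
rewrite (bigD1 i) //= placeE arci big1 ?addr0 // => j ji; rewrite placeE.
case/andP: arci => /eqP zi _; case: andP => // -[_ /forallP/(_ i)].
rewrite eq_sym ji zi /= -subr_eq0 addrC addKr => /eqP.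
by move/(congr1 val).
Qed.

(** The [x] with [Delta x] in the algebra are closed under linear combinations and brackets. From
    [E_11], [E_22] and [A = E_01 + E_12 + E_20], brackets isolate [E_12] and [E_01], hence [E_20];
    these generate the other off-diagonal units, and [[E_01, E_10] + E_11 = E_00]. *)
Lemma Terwilliger_Delta (x : 'M[C]_3) : Terwilliger (Delta d x).
Proof.
pose T := @Terwilliger C d.
have Tadd M N : T M -> T N -> T (M + N) by apply: gen_add.
have Tscale c M : T M -> T (c *: M) by apply: gen_scale.
have Tmul M N : T M -> T N -> T (M *m N) by apply: gen_mul.
have T1 : T 1%:M by apply: gen_one.
have TB := closedB Tadd Tscale.
have Tsum J (r : seq J) (Q : pred J) F (TF : forall j, Q j -> T (F j)) :
    T (\sum_(j <- r | Q j) F j).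
  exact: (closed_sum T1 Tadd Tscale).
have TDD x1 x2 : T (Delta d x1) -> T (Delta d x2) -> T (Delta d (x1 + x2)).
  by rewrite DeltaD; apply: Tadd.
have TDZ c x1 : T (Delta d x1) -> T (Delta d (c *: x1)).
  by rewrite DeltaZ; apply: Tscale.
have TDB x1 x2 : T (Delta d x1) -> T (Delta d x2) -> T (Delta d (x1 - x2)).
  by move=> T1' T2'; rewrite -scaleN1r; apply/TDD/TDZ.
have TDC x1 x2 : T (Delta d x1) -> T (Delta d x2) -> T (Delta d (x1 *m x2 - x2 *m x1)).
  by move=> T1' T2'; rewrite -Delta_comm; apply: TB; apply: Tmul.
pose e (a b : 'I_3) : 'M[C]_3 := delta_mx a b.
have eM a b a' b' : e a b *m e a' b' = e a b' *+ (b == a') by apply: mul_delta_mx_cond.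
have Tdiag (a : 'I_3) (c : nat -> nat -> nat) :
    (forall y : Xd d, cnt (a : 'Z_3) y = c (cnt 1 y) (cnt 2 y)) -> T (Delta d (e a a)).
  move=> cE.
  suff -> : Delta d (e a a) = \sum_(k < d.+1) \sum_(l < d.+1) (c k l)%:R *: Estar C d k l.
    do 2![apply: (Tsum) => ? _]; apply: Tscale; apply: gen_base; do 2!right.
    by do 2!eexists.
  apply: entX_inj => y z; rewrite entX_Delta_diag.
  have cntd b : (cnt b y < d.+1)%N by rewrite ltnS (leq_trans (max_card _)) ?card_ord.
  rewrite entX_sum (bigD1 (Ordinal (cntd 1))) //= [X in _ + X]big1 ?addr0 => [|k kE]; last first.
    rewrite entX_sum big1 // => l _; rewrite entXZ entX_mxX [(cnt 1 y == k)]eq_sym.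
    rewrite -[cnt 1 y]/(val (Ordinal (cntd 1))).
    by rewrite (inj_eq val_inj) (negPf kE) andbF mulr0.
  rewrite entX_sum (bigD1 (Ordinal (cntd 2))) //= [X in _ + X]big1 ?addr0 => [|l lE]; last first.
    rewrite entXZ entX_mxX [(cnt 2 y == l)]eq_sym.
    rewrite -[cnt 2 y]/(val (Ordinal (cntd 2))).
    by rewrite (inj_eq val_inj) (negPf lE) andbF mulr0.
  by rewrite entXZ entX_mxX !eqxx !andbT cE mulrC.
pose i0 : 'I_3 := 0; pose i1 : 'I_3 := 1; pose i2 : 'I_3 := 2.
have T11 : T (Delta d (e i1 i1)) by apply: (Tdiag _ (fun k l => k)).
have T22 : T (Delta d (e i2 i2)) by apply: (Tdiag _ (fun k l => l)).
pose A := e i0 i1 + e i1 i2 + e i2 i0.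
have TA : T (Delta d A).
  rewrite (_ : A = \matrix_(a < 3, b < 3) ((b : 'Z_3) == (a : 'Z_3) + 1)%:R).
    by rewrite -adjA_Delta; apply: gen_base; left.
  apply/matrixP => a b; rewrite !mxE.
  by case: a => [[|[|[|//]]] ?]; case: b => [[|[|[|//]]] ?]; rewrite !eqE /= ?addr0 ?add0r.
have comm1 : e i1 i1 *m A - A *m e i1 i1 = e i1 i2 - e i0 i1.
  by rewrite !mulmxDr !mulmxDl !eM /= !(mulr0n, mulr1n, addr0, add0r).
have comm2 : (e i1 i2 - e i0 i1) *m e i2 i2 - e i2 i2 *m (e i1 i2 - e i0 i1) = e i1 i2.
  by rewrite !mulmxBr !mulmxBl !eM /= !(mulr0n, mulr1n, addr0, add0r, subr0, oppr0).
have T12 : T (Delta d (e i1 i2)) by rewrite -comm2 -comm1; apply: (TDC) => //; apply: TDC.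
have T01 : T (Delta d (e i0 i1)).
  have -> : e i0 i1 = e i1 i2 - (e i1 i2 - e i0 i1) by rewrite subKr.
  by rewrite -comm1; apply: TDB => //; apply: TDC.
have T20 : T (Delta d (e i2 i0)).
  have -> : e i2 i0 = A - (e i0 i1 + e i1 i2) by rewrite /A addrC addKr.
  by apply: TDB => //; apply: TDD.
have Te a b c : a != c -> T (Delta d (e a b)) -> T (Delta d (e b c)) -> T (Delta d (e a c)).
  move=> /negPf ac Tab Tbc; have := TDC _ _ Tab Tbc.
  by rewrite !eM eqxx [c == a]eq_sym ac mulr0n mulr1n subr0.
have T02 : T (Delta d (e i0 i2)) by apply: (Te _ i1).
have T10 : T (Delta d (e i1 i0)) by apply: (Te _ i2).
have T21 : T (Delta d (e i2 i1)) by apply: (Te _ i0).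
have T00 : T (Delta d (e i0 i0)).
  have -> : e i0 i0 = e i0 i1 *m e i1 i0 - e i1 i0 *m e i0 i1 + e i1 i1.
    by rewrite !eM /= !mulr1n subrK.
  by apply: TDD => //; apply: TDC.
rewrite [x]matrix_sum_delta !big_ord_recl !big_ord0 !addr0.
have ordE : (lift ord0 ord0 = i1 :> 'I_3) *
    (lift ord0 (lift ord0 ord0) = i2 :> 'I_3) * (ord0 = i0 :> 'I_3).
  by split; [split|]; apply: val_inj.
by rewrite !ordE; do ![apply: (TDD)]; apply: TDZ.
Qed.

Lemma SymX_Terwilliger (M : MatX C d) : SymX M -> Terwilliger M.
Proof.
apply: closed_SymX; first exact: gen_one.
- exact: gen_add.
- exact: gen_scale.
- exact: gen_mul.
exact: Terwilliger_Delta.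
Qed.

End TerwilligerTensors.

(** * Column-antisymmetric vectors *)

Section Coordinates.
Variables (C : comNzRingType) (d : nat).

Definition cooX (w : 'rV[C]_#|{: Xd d}|) (y : Xd d) : C := w 0 (enum_rank y).

Lemma cooX_inj w w' : cooX w =1 cooX w' -> w = w'.
Proof.
by move=> eq_w; apply/rowP => j; have := eq_w (enum_val j); rewrite /cooX enum_valK.
Qed.

Lemma cooX_mul w (M : MatX C d) y : cooX (w *m M) y = \sum_z cooX w z * entX M z y.
Proof. by rewrite /cooX mxE sum_enum_rank. Qed.

Lemma cooXZ c w y : cooX (c *: w) y = c * cooX w y.
Proof. by rewrite /cooX mxE. Qed.

Lemma cooX_Estar w (k l : nat) y :
  cooX (w *m Estar C d k l) y = cooX w y * ((cnt 1%R y == k) && (cnt 2%R y == l))%:R.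
Proof.
rewrite cooX_mul (bigD1 y) //= big1 ?addr0 => [|z zy].
  by rewrite entX_mxX eqxx.
by rewrite entX_mxX (negPf zy) mulr0.
Qed.

Lemma cnt_sum (y : Xd d) : (cnt 0%R y + cnt 1%R y + cnt 2%R y = d)%N.
Proof.
rewrite -[RHS]card_ord -sum1_card (partition_big y xpredT) //=.
rewrite !big_ord_recl big_ord0 addn0 addnA !sum1dep_card /cnt.
by congr (_ + _ + _)%N; apply: eq_card => i; rewrite !inE //;
   congr (_ == _); apply: val_inj.
Qed.

End Coordinates.

Section Shape.
Variables (C : numClosedFieldType) (d : nat).
(** Place [i] is the box in column [col i] and row [z0 i] of a diagram; the hypotheses say that
    distinct places are distinct boxes and that columns are filled from the top. *)
Variables (col : 'I_d -> nat) (z0 : Xd d).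
Hypothesis shape_inj : forall i j, col i = col j -> z0 i = z0 j -> i = j.
Hypothesis shape_top : forall i, exists2 j, col j = col i & z0 j = 0.
Hypothesis shape_mid : forall i, z0 i = 2 -> exists2 j, col j = col i & z0 j = 1.
Implicit Types (s t : {perm 'I_d}) (y z : Xd d) (M : MatX C d).

Lemma Z3_cases (a : 'Z_3) : [\/ a = 0, a = 1 | a = 2].
Proof.
case: a => [[|[|[|//]]] ?];
  [apply: Or31 | apply: Or32 | apply: Or33]; exact: val_inj.
Qed.

Definition colstab s := [forall i, col (s i) == col i].

Lemma colstabP s : reflect (forall i, col (s i) = col i) (colstab s).
Proof. exact: 'forall_eqP. Qed.

Lemma colstab_mul t s : colstab t -> colstab (t * s) = colstab s.
Proof.
move=> /colstabP ct; apply/colstabP/colstabP => cs i.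
  by have := cs ((t^-1)%g i); rewrite permM permKV -[RHS]ct permKV.
by rewrite permM cs ct.
Qed.

Definition hw y : C := \sum_(s | colstab s) (-1) ^+ s * (y == permX s z0)%:R.

Definition hwv : 'rV[C]_#|{: Xd d}| := \row_j hw (enum_val j).

Lemma cooX_hwv y : cooX hwv y = hw y.
Proof. by rewrite /cooX mxE enum_rankK. Qed.

Lemma hw_perm t y : colstab t -> hw (permX t y) = (-1) ^+ t * hw y.
Proof.
move=> ct; rewrite /hw (reindex_inj (mulgI t)) mulr_sumr /=.
apply: eq_big => [s|s _]; first exact: colstab_mul.
rewrite -permXM (inj_eq (@permX_inj _ _)) mulrA; congr (_ * _).
by rewrite odd_permM signr_addb.
Qed.

Lemma hw_z0 : hw z0 = 1.
Proof.
rewrite /hw (bigD1 1%g) /=; last by apply/colstabP => i; rewrite perm1.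
rewrite odd_perm1 permX1 eqxx mulr1 big1 ?addr0 // => s /andP[/colstabP cs s1].
case: eqP => [z0s|]; last by rewrite mulr0.
case/eqP: s1; apply/permP => i; rewrite perm1; apply: shape_inj => //.
by rewrite {2}z0s ffunE.
Qed.

Lemma hw_supp y : hw y != 0 -> exists2 s, colstab s & y = permX s z0.
Proof.
move=> hwy; suff /exists_inP[s cs /eqP]: [exists (s | colstab s), y == permX s z0] by exists s.
apply: contraNT hwy => /exists_inPn ns; rewrite /hw big1 // => s cs.
by rewrite (negPf (ns s cs)) mulr0.
Qed.

Lemma hw_real y : (hw y)^* = hw y.
Proof.
rewrite /hw rmorph_sum; apply: eq_bigr => s _.
by rewrite rmorphM rmorph_sign rmorph_nat.
Qed.

(** Symmetric matrices commute with permutations of places, so column antisymmetry passes from [hwv]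
    to its images. *)
Lemma hwv_mul_perm M t y : SymX M -> colstab t ->
  cooX (hwv *m M) (permX t y) = (-1) ^+ t * cooX (hwv *m M) y.
Proof.
move=> SM ct; rewrite !cooX_mul (reindex_permX t) mulr_sumr.
by apply: eq_bigr => z _; rewrite SM !cooX_hwv hw_perm // mulrA.
Qed.

Definition col_inj y := forall i j, col i = col j -> y i = y j -> i = j.

(** A word repeating a letter within a column is fixed by a transposition in [colstab], so its
    coordinate is its own negative. *)
Lemma hwv_mul_col_inj M y : SymX M -> cooX (hwv *m M) y != 0 -> col_inj y.
Proof.
move=> SM wy i j cij yij; apply/eqP; apply: contraNT wy => ij.
have ct : colstab (tperm i j) by apply/colstabP => k; case: tpermP => [->|->|].
have := hwv_mul_perm y SM ct.
have -> : permX (tperm i j) y = y.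
  by apply/ffunP => k; rewrite ffunE; case: tpermP => [->|->|].
rewrite odd_tperm ij expr1 mulN1r => /eqP.
by rewrite -addr_eq0 -mulr2n mulrn_eq0.
Qed.

Lemma top_choice : exists top : 'I_d -> 'I_d, forall i, col (top i) = col i /\ z0 (top i) = 0.
Proof.
have /fin_all_exists[top topE] : forall i, exists j, col j = col i /\ z0 j = 0.
  by move=> i; have [j] := shape_top i; exists j.
by exists top.
Qed.

Lemma col_inj_cnt0 y : col_inj y -> (cnt 0%R y <= cnt 0%R z0)%N.
Proof.
move=> yI; have [top topE] := top_choice.
rewrite {1}/cnt -(@card_in_imset _ _ top [set i | y i == 0]) => [|i j].
  apply: subset_leq_card; apply/subsetP => _ /imsetP[i _ ->].
  by rewrite inE (topE i).2.
rewrite !inE => /eqP yi /eqP yj tij; apply: yI; last by rewrite yi yj.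
by rewrite -(topE i).1 tij (topE j).1.
Qed.

(** A column with a box in row 2 has three boxes, whose letters in [y] are distinct, so one of them
    is 2. *)
Lemma col_inj_two y : col_inj y ->
  exists f : 'I_d -> 'I_d, forall i, z0 i = 2 -> col (f i) = col i /\ y (f i) = 2.
Proof.
move=> yI; suff /fin_all_exists[f fE] : forall i, exists j,
    z0 i = 2 -> col j = col i /\ y j = 2 by exists f.
move=> i; have [zi|] := eqVneq (z0 i) 2; last by move=> /eqP; exists i.
have [j cj zj] := shape_mid zi; have [k ck zk] := shape_top i.
have yij : y i <> y j by move=> /yI; rewrite cj => /(_ erefl) ij; rewrite ij zj in zi.
have yik : y i <> y k by move=> /yI; rewrite ck => /(_ erefl) ik; rewrite ik zk in zi.
have yjk : y j <> y k by move=> /yI; rewrite cj ck => /(_ erefl) jk; rewrite jk zk in zj.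
case: (Z3_cases (y i)) => yi; last by exists i.
  case: (Z3_cases (y j)) => yj; [by rewrite yi yj in yij| |by exists j].
  by exists k; case: (Z3_cases (y k)) => yk //; [rewrite yi yk in yik | rewrite yj yk in yjk].
case: (Z3_cases (y j)) => yj; [|by rewrite yi yj in yij|by exists j].
by exists k; case: (Z3_cases (y k)) => yk //; [rewrite yj yk in yjk | rewrite yi yk in yik].
Qed.

Lemma two_inj y (f : 'I_d -> 'I_d) :
  (forall i, z0 i = 2 -> col (f i) = col i /\ y (f i) = 2) ->
  {in [set i | z0 i == 2] &, injective f}.
Proof.
move=> fE i j; rewrite !inE => /eqP zi /eqP zj fij; apply: shape_inj; last by rewrite zi zj.
by rewrite -(fE i zi).1 fij (fE j zj).1.
Qed.

Lemma col_inj_cnt2 y : col_inj y -> (cnt 2%R z0 <= cnt 2%R y)%N.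
Proof.
move=> yI; have [f fE] := col_inj_two yI.
rewrite {1}/cnt -(card_in_imset (two_inj fE)).
apply: subset_leq_card; apply/subsetP => _ /imsetP[i + ->].
by rewrite !inE => /eqP /fE[_ ->].
Qed.

(** Equality of the counts puts a 0 in every column and confines the 2s to columns of length 3, so
    each column of [y] rearranges that of [z0]. *)
Lemma col_inj_extremal y : col_inj y -> cnt 0%R y = cnt 0%R z0 -> cnt 2%R y = cnt 2%R z0 ->
  exists2 s, colstab s & y = permX s z0.
Proof.
move=> yI cnt0 cnt2; have [top topE] := top_choice; have [f fE] := col_inj_two yI.
have zero_in i : exists2 j, col j = col i & y j = 0.
  have topI : {in [set i | y i == 0] &, injective top}.
    move=> j k; rewrite !inE => /eqP yj /eqP yk tjk; apply: yI; last by rewrite yj yk.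
    by rewrite -(topE j).1 tjk (topE k).1.
  have : top @: [set i | y i == 0] == [set i | z0 i == 0].
    rewrite eqEcard card_in_imset //; apply/andP; split; last by rewrite -/(cnt 0%R z0) -cnt0.
    by apply/subsetP => _ /imsetP[j _ ->]; rewrite inE (topE j).2.
  move=> /eqP/setP/(_ (top i)); rewrite inE (topE i).2 eqxx => /imsetP[j].
  by rewrite inE => /eqP yj tij; exists j; rewrite // -(topE j).1 -tij (topE i).1.
have two_at j : y j = 2 -> exists2 i, col i = col j & z0 i = 2.
  have : f @: [set i | z0 i == 2] == [set i | y i == 2].
    rewrite eqEcard (card_in_imset (two_inj fE)); apply/andP; split; last first.
      by rewrite -/(cnt 2%R z0) -cnt2.
    by apply/subsetP => _ /imsetP[i + ->]; rewrite !inE => /eqP/fE[_ ->].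
  move=> /eqP/setP/(_ j); rewrite inE => + yj; rewrite yj eqxx => /imsetP[i].
  by rewrite inE => /eqP zi ->; exists i; rewrite // (fE i zi).1.
have /fin_all_exists2[g cg zg] : forall i, exists2 j, col j = col i & z0 j = y i.
  move=> i; case: (Z3_cases (y i)) => yi; rewrite yi; [exact: shape_top | | exact: two_at].
  have [j cj yj] := zero_in i.
  (* A letter 1 shares its column with a 0, so that column has a second box and therefore one in row
     1. *)
  have [k ck zk] : exists2 k, col k = col i & z0 k <> 0.
    have [zi|] := eqVneq (z0 i) 0; last by move=> /eqP; exists i.
    exists j => // zj; have ji : j = i by apply: shape_inj; rewrite // zj zi.
    by rewrite ji yi in yj.
  by case: (Z3_cases (z0 k)) => // [|/shape_mid[j' cj' zj']]; [exists k | exists j'; rewrite ?cj'].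
have gI : injective g.
  by move=> i j gij; apply: yI; [rewrite -cg gij cg | rewrite -zg gij zg].
exists (perm gI); first by apply/colstabP => i; rewrite permE.
by apply/ffunP => i; rewrite ffunE permE zg.
Qed.

Definition hwE : MatX C d := Estar C d (cnt 1%R z0) (cnt 2%R z0).

Lemma cnt0_eq y : cnt 1%R y = cnt 1%R z0 -> cnt 2%R y = cnt 2%R z0 -> cnt 0%R y = cnt 0%R z0.
Proof. by move=> c1 c2; have := cnt_sum y; have := cnt_sum z0; lia. Qed.

(** The nonzero coordinates kept by [hwE] sit at extremal words, that is, column rearrangements of
    [z0], where antisymmetry determines them from the one at [z0]. *)
Lemma hwv_line M : SymX M -> hwv *m M *m hwE = cooX (hwv *m M) z0 *: hwv.
Proof.
move=> SM; apply: cooX_inj => y; rewrite cooX_Estar cooXZ cooX_hwv.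
case: andP => [[/eqP c1 /eqP c2]|nc]; rewrite ?mulr1 ?mulr0.
  have [wy|/(hwv_mul_col_inj SM) yI] := eqVneq (cooX (hwv *m M) y) 0.
    have [->|/hw_supp[s cs ys]] := eqVneq (hw y) 0; first by rewrite wy mulr0.
    rewrite wy; apply/esym/eqP; rewrite mulf_eq0; apply/orP; left.
    by move/eqP: wy; rewrite ys hwv_mul_perm // mulf_eq0 signr_eq0.
  have [s cs ->] := col_inj_extremal yI (cnt0_eq c1 c2) c2.
  by rewrite hwv_mul_perm // hw_perm // hw_z0 mulr1 mulrC.
have [->|/hw_supp[s cs ys]] := eqVneq (hw y) 0; first by rewrite mulr0.
by case: nc; rewrite ys !cnt_permX.
Qed.

(** Take the conjugate transpose of [M] as [N]. If the coordinate at [z0] vanished, [hwv_line] would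
    make [hwv *m M *m N] orthogonal to the real vector [hwv], but that pairing is the squared norm
    of [hwv *m M]. *)
Lemma hwv_nondeg M : SymX M -> hwv *m M != 0 ->
  exists2 N, SymX N & cooX (hwv *m M *m N) z0 != 0.
Proof.
move=> SM w0; pose N : MatX C d := map_mx Num.conj M^T.
have NE y z : entX N y z = (entX M z y)^* by rewrite /entX !mxE.
have SN : SymX N by move=> s y z; rewrite !NE SM.
exists N => //; apply: contraNneq w0 => wN0.
have SMN := SymX_mul SM SN.
have norm0 : \sum_x cooX (hwv *m M) x * (cooX (hwv *m M) x)^* = 0.
  transitivity (\sum_y cooX (hwv *m M *m N) y * hw y).
    under [RHS]eq_bigr do rewrite cooX_mul mulr_suml.
    rewrite exchange_big; apply: eq_bigr => x _ /=.
    rewrite {2}cooX_mul rmorph_sum mulr_sumr; apply: eq_bigr => y _ /=.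
    by rewrite rmorphM /= cooX_hwv hw_real NE -mulrA [hw y * _]mulrC.
  rewrite big1 // => y _; have [->|/hw_supp[s cs ys]] := eqVneq (hw y) 0.
    by rewrite mulr0.
  have := congr1 (fun u => cooX u y) (hwv_line SMN); rewrite cooXZ mulmxA wN0 mul0r.
  by rewrite cooX_Estar ys !cnt_permX !eqxx mulr1 => ->; rewrite mul0r.
apply/eqP/cooX_inj => x; rewrite [RHS]mxE; apply/eqP.
have : cooX (hwv *m M) x * (cooX (hwv *m M) x)^* == 0.
  by apply/eqP; apply: (psumr_eq0P _ norm0) => // y _; apply: mul_conjC_ge0.
by rewrite mul_conjC_eq0.
Qed.

End Shape.

(** * Lower bound for the dimension of the blocks *)

(** Evaluation at the [x j] is triangular for [q] with nonzero diagonal; the coefficients of a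
    vanishing combination are killed starting from the largest [q]. *)
Lemma triangular_rank (F : fieldType) (k n : nat) (W : 'M[F]_(k, n)) (J : finType)
    (u : J -> 'rV[F]_n) (x : J -> 'I_n) (q : J -> nat) :
  (forall j, u j <= W)%MS -> (forall j, u j 0 (x j) != 0) ->
  (forall j j', u j 0 (x j') != 0 -> j = j' \/ (q j' < q j)%N) ->
  (#|J| <= \rank W)%N.
Proof.
move=> uW diag upper; pose A : 'M_(#|J|, n) := \matrix_a u (enum_val a).
have AW : (A <= W)%MS by apply/row_subP => a; rewrite rowK.
suff /eqP <- : row_free A by apply: mxrankS.
apply: inj_row_free => c cA0.
suff c0 j : c 0 (enum_rank j) = 0.
  by apply/rowP => a; rewrite -(enum_valK a) c0 mxE.
pose K := \max_(i : J) q i; have [e lt_e] := ubnP (K - q j)%N.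
elim: e j lt_e => // e IH j lt_e.
have := congr1 (fun w : 'rV_n => w 0 (x j)) cA0; rewrite !mxE sum_enum_rank (bigD1 j) //=.
rewrite big1 => [|i ij]; last first.
  rewrite mxE enum_rankK; have [->|/upper[ijE|lt_q]] := eqVneq (u i 0 (x j)) 0.
  - by rewrite mulr0.
  - by rewrite ijE eqxx in ij.
  - rewrite IH ?mul0r //; have : (q i <= K)%N by apply: leq_bigmax.
    by lia.
by rewrite addr0 mxE enum_rankK => /eqP; rewrite mulf_eq0 (negPf (diag j)) orbF => /eqP.
Qed.

Lemma card_ord_interval (n x y : nat) : (y <= n)%N ->
  #|[set i : 'I_n | (x <= i < y)%N]| = (y - x)%N.
Proof.
elim: y => [|y IH] lt_yn.
  by apply/eqP; rewrite cards_eq0; apply/eqP/setP => i; rewrite !inE ltn0 andbF.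
have [le_xy|lt_yx] := leqP x y; last first.
  rewrite (_ : (y.+1 - x)%N = 0%N); last by lia.
  by apply/eqP; rewrite cards_eq0; apply/eqP/setP => i; rewrite !inE; lia.
rewrite subSn // -IH ?(ltnW lt_yn) //.
rewrite (_ : [set i : 'I_n | _] = Ordinal lt_yn |: [set i : 'I_n | (x <= i < y)%N]).
  by rewrite cardsU1 inE /= ltnn andbF.
by apply/setP => i; rewrite !inE -val_eqE /=; lia.
Qed.

Section Raising.
Variables (C : comNzRingType) (d : nat).
Implicit Types (y z : Xd d).

Definition jump (a b : 'Z_3) z y := #|[set i | (z i == a) && (y i == b)]|.

(** The coefficient of [x^p y^q z^r] in the [d]-th tensor power of the unitriangular matrix with
    entries [x], [y], [z] at the positions 01, 02, 12. *)
Definition raise_mx (p q r : nat) : MatX C d :=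
  mxX (fun z y => [&& jump 0 1 z y == p, jump 0 2 z y == q, jump 1 2 z y == r
                    & [forall i, (z i <= y i)%N]]%:R).

Lemma SymX_raise_mx p q r : SymX (raise_mx p q r).
Proof.
apply: SymX_mxX => s y z.
have jumpP a b : jump a b (permX s y) (permX s z) = jump a b y z.
  rewrite -[RHS](card_permX s (fun i => (y i == a) && (z i == b))).
  by apply: eq_card => i; rewrite !inE !ffunE.
rewrite !jumpP (_ : [forall i, _] = [forall i, (y i <= z i)%N]) //.
apply/forallP/forallP => yz i; last by rewrite !ffunE.
by have := yz ((s^-1)%g i); rewrite !ffunE permKV.
Qed.

End Raising.

(** * Three-row diagrams and their test words *)

Section HookShape.
Variables (d l m : nat).
Hypothesis le_lm : (3 * l + 2 * m <= d)%N.
Local Notation a := (d - 3 * l - 2 * m)%N.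
Local Notation R0 := (d - 2 * l - m)%N.

(* Positions are numbered row by row, the rows having lengths R0, l + m and l. *)
Definition shape_row (i : nat) : nat :=
  if (i < R0)%N then 0 else if (i < d - l)%N then 1 else 2.

Definition shape_col (i : nat) : nat :=
  if (i < R0)%N then i else if (i < d - l)%N then (i - R0)%N else (i - (d - l))%N.

Definition shape_word : Xd d := [ffun i : 'I_d => inord (shape_row i) : 'Z_3].

Lemma shape_wordE (i : 'I_d) : shape_word i = shape_row i :> nat.
Proof.
by rewrite ffunE inordK // /shape_row; do !case: ifP.
Qed.

Let Z3_val : (((0 : 'Z_3) = 0%N :> nat) *
  ((1 : 'Z_3) = 1%N :> nat) * ((2 : 'Z_3) = 2%N :> nat))%type.
Proof. by []. Qed.

Let Z3_eqE (x : 'Z_3) : (((x == 0) = (x == 0%N :> nat)) * ((x == 1) = (x == 1%N :> nat))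
  * ((x == 2) = (x == 2%N :> nat)))%type.
Proof. by []. Qed.

Lemma shape_word_eq (i : 'I_d) (k : 'Z_3) :
  (shape_word i == k) = (shape_row i == k :> nat).
Proof. by rewrite -val_eqE /= shape_wordE. Qed.

Lemma shape_inj (i j : 'I_d) : shape_col i = shape_col j ->
  shape_word i = shape_word j -> i = j.
Proof.
move=> cij /(congr1 val) /=; rewrite !shape_wordE => rij; apply: val_inj; move: cij rij.
by rewrite /shape_row /shape_col /=; do !case: ifP => ?; lia.
Qed.

Lemma shape_col_lt i : (i < d)%N -> (shape_col i < R0)%N.
Proof. by rewrite /shape_col; do !case: ifP => ?; lia. Qed.

Lemma shape_top (i : 'I_d) :
  exists2 j : 'I_d, shape_col j = shape_col i & shape_word j = 0.
Proof.
have lt_c := shape_col_lt (ltn_ord i).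
have lt_d : (shape_col i < d)%N by lia.
exists (Ordinal lt_d); first by rewrite {1}/shape_col /= lt_c.
by apply: val_inj; rewrite /= shape_wordE /shape_row lt_c.
Qed.

Lemma shape_mid (i : 'I_d) : shape_word i = 2 ->
  exists2 j : 'I_d, shape_col j = shape_col i & shape_word j = 1.
Proof.
move=> /(congr1 val) /=; rewrite shape_wordE => ri2.
have {ri2} ri : shape_row i = 2%N by exact: ri2.
have lt_d : (R0 + shape_col i < d - l)%N.
  have := ltn_ord i; move: ri; rewrite /shape_row /shape_col /=; do !case: ifP => ?; lia.
have lt_d' : (R0 + shape_col i < d)%N by lia.
exists (Ordinal lt_d').
  by rewrite {1}/shape_col /= lt_d; case: ifP => ?; lia.
by apply: val_inj; rewrite /= shape_wordE /shape_row /= lt_d ifF //; lia.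
Qed.

Lemma shape_cnt0 : cnt 0 shape_word = R0.
Proof.
rewrite -[RHS]subn0 -(@card_ord_interval d) /cnt; last by lia.
apply: eq_card => i; rewrite !inE shape_word_eq Z3_val /shape_row.
by do !case: ifP => ?; lia.
Qed.

Lemma shape_cnt2 : cnt 2 shape_word = l.
Proof.
rewrite (_ : l = d - (d - l))%N; last by lia.
rewrite -(@card_ord_interval d) // /cnt.
apply: eq_card => i; rewrite !inE shape_word_eq Z3_val /shape_row.
by have := ltn_ord i; do !case: ifP => ?; lia.
Qed.

(* The tableau with rho = p + q - a columns (1,2), r - rho columns (0,2) and
   m - r columns (0,1) of length 2, and with q entries 2 and p - rho entries 1
   in the columns of length 1; truncated subtraction makes rho = 0 if p + q < a. *)
Definition test_row (p q r i : nat) : nat :=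
  let c := shape_col i in
  if (c < l)%N then shape_row i
  else if (c < l + m)%N then
    if shape_row i == 0%N then (c < l + (p + q - a))%N : nat
    else ((c < l + r)%N).+1
  else if (c < l + m + q)%N then 2
  else (c < l + m + p + q - (p + q - a))%N : nat.

Definition test_word p q r : Xd d := [ffun i : 'I_d => inord (test_row p q r i) : 'Z_3].

Lemma test_wordE p q r (i : 'I_d) : test_word p q r i = test_row p q r i :> nat.
Proof.
rewrite ffunE inordK // ltnS /test_row /=.
case: ifP => _; first by rewrite /shape_row; do !case: ifP.
case: ifP => _; first by case: ifP => _; case: (_ < l + _)%N.
by case: ifP => _ //; case: (_ < _)%N.
Qed.

Lemma test_word_eq p q r (i : 'I_d) (k : 'Z_3) :
  (test_word p q r i == k) = (test_row p q r i == k :> nat).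
Proof. by rewrite -val_eqE /= test_wordE. Qed.

Section Jumps.
Variables p q r : nat.
Hypotheses (le_r : (r <= m)%N) (le_q : (q <= a)%N) (le_p : (p + q <= a + r)%N).

Lemma jump02_test : jump 0 2 shape_word (test_word p q r) = q.
Proof.
rewrite [RHS](_ : q = (l + m + q) - (l + m))%N; last by lia.
rewrite -(@card_ord_interval d); last by lia.
apply: eq_card => i; rewrite !inE shape_word_eq test_word_eq !Z3_val.
rewrite /test_row /shape_row /shape_col.
by have := ltn_ord i; do !case: ifP => ?; lia.
Qed.

Lemma jump12_test : jump 1 2 shape_word (test_word p q r) = r.
Proof.
rewrite [RHS](_ : r = (R0 + l + r) - (R0 + l))%N; last by lia.
rewrite -(@card_ord_interval d); last by lia.
apply: eq_card => i; rewrite !inE shape_word_eq test_word_eq !Z3_val.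
rewrite /test_row /shape_row /shape_col.
by have := ltn_ord i; do !case: ifP => ?; lia.
Qed.

Lemma jump01_test : jump 0 1 shape_word (test_word p q r) = p.
Proof.
(* Jumps from 0 to 1 occur on top of [rho] columns of length 2 ([S1]) and in [p - rho] columns of
   length 1 ([S2]). *)
pose rho := (p + q - a)%N.
pose S1 := [set i : 'I_d | (l <= i < l + rho)%N].
pose S2 := [set i : 'I_d | (l + m + q <= i < l + m + p + q - rho)%N].
transitivity #|S1 :|: S2|.
  apply: eq_card => i; rewrite !inE shape_word_eq test_word_eq !Z3_val.
  rewrite /test_row /shape_row /shape_col.
  by have := ltn_ord i; rewrite /rho; do !case: ifP => ?; lia.
rewrite cardsU (_ : S1 :&: S2 = set0); last first.
  by apply/setP => i; rewrite !inE /rho; lia.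
by rewrite cards0 !card_ord_interval /rho; lia.
Qed.

End Jumps.

Local Notation colf := (fun i : 'I_d => shape_col i).

Lemma shape_row_col (i : 'I_d) :
  [\/ shape_row i = 0%N /\ shape_col i = i,
      shape_row i = 1%N /\ i = (R0 + shape_col i)%N :> nat /\ (shape_col i < l + m)%N |
      shape_row i = 2%N /\ (shape_col i < l)%N].
Proof.
have lt_i := ltn_ord i; rewrite /shape_row /shape_col.
case: ltnP => ?; first by constructor.
by case: ltnP => ?; [constructor 2 | constructor 3]; lia.
Qed.

(** Columns of length 1 are fixed by [s], so their [q'] letters 2 are jumps from 0 to 2 and
    [q' <= q]. In case of equality longer columns admit no such jump, and since letters may only
    rise, [s] preserves rows 0, 1 and 2 in turn and is trivial. *)
Lemma raise_triangular (C : numFieldType) (s : {perm 'I_d}) p q r p' q' r' :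
  (r' <= m)%N -> (q' <= a)%N -> (p' + q' <= a + r')%N -> colstab colf s ->
  entX (raise_mx C d p q r) (permX s shape_word) (test_word p' q' r') != 0 ->
  (q' < q)%N \/ [/\ s = 1%g, p = p', q = q' & r = r'].
Proof.
move=> le_r le_q le_p /colstabP cs; rewrite entX_mxX pnatr_eq0 eqb0 negbK.
set z := permX s _; set y := test_word _ _ _.
move=> /and4P[/eqP j01 /eqP j02 /eqP j12 /forallP zy].
have zE i : z i = shape_row (s i) :> nat by rewrite ffunE shape_wordE.
have {}zy i : (shape_row (s i) <= test_row p' q' r' i)%N.
  by rewrite -zE -test_wordE; apply: zy.
have pos_inj (i j : 'I_d) : shape_col i = shape_col j -> shape_row i = shape_row j -> i = j.
  by move=> cij rij; apply: shape_inj => //; apply: val_inj; rewrite /= !shape_wordE.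
have fixed (i : 'I_d) : (l + m <= shape_col i)%N -> s i = i.
  move=> le_c; have csi := cs i.
  by case: (shape_row_col i) (shape_row_col (s i)) => [[ri ci]|[ri [ei ci]]|[ri ci]]
    [[rsi csi']|[rsi [esi csi']]|[rsi csi']]; apply: pos_inj; lia.
pose S := [set i : 'I_d | (l + m <= i < l + m + q')%N].
pose Z := [set i | (z i == 0) && (y i == 2)].
have SZ : S \subset Z.
  apply/subsetP => i; rewrite !inE !Z3_eqE zE test_wordE => iS.
  have ci : shape_col i = i by rewrite /shape_col; case: ltnP => //; lia.
  rewrite fixed ?ci //; last by lia.
  by rewrite /test_row ci /shape_row; do !case: ltnP => ?; lia.
have cS : #|S| = q' by rewrite card_ord_interval; lia.
have := subset_leq_card SZ; rewrite cS -[#|Z|]/(jump 0 2 z y) j02.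
rewrite leq_eqVlt => /predU1P[eq_q|]; last by left.
have {}SZ : S = Z by apply/eqP; rewrite eqEcard SZ cS eq_q -j02 /=.
have row0 (i : 'I_d) : shape_row i = 0%N -> shape_row (s i) = 0%N.
  case: (shape_row_col i) => [[_ ci]|[-> //]|[-> //]] ri.
  have [le_c|lt_c] := leqP (l + m) i; first by rewrite fixed // ci.
  have := zy i; rewrite /test_row ri /= ci lt_c.
  case: ltnP => [_|le_l]; first by case: (shape_row _).
  case: ltnP => [lt_rho|_]; last by case: (shape_row _).
  (* Swapping a column of length 2 whose test letter on top is 1 would put the 0 in the lower box,
     where the test letter is 2 because [p' + q' - a <= r']: a jump outside [S]. *)
  case: (shape_row_col (s i)) => [[-> //]|[rsi [esi csi]] _|[-> //]].
  have ssi : s (s i) != s i by rewrite (inj_eq perm_inj);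
    apply: contra_eq_neq rsi => ->; rewrite ri.
  have css := cs (s i); have csi' := cs i.
  suff : s i \in Z by rewrite -SZ inE; lia.
  rewrite inE !Z3_eqE zE test_wordE.
  have -> : shape_row (s (s i)) = 0%N.
    case: (shape_row_col (s (s i))) => [[-> //]|[rss _]|[_]]; last by lia.
    by case/eqP: ssi; apply: pos_inj; rewrite ?rss.
  rewrite /test_row rsi csi' ci lt_c /= ltnNge le_l /=.
  by rewrite (_ : (i < l + r')%N) //; lia.
have row_ne (i j : 'I_d) : shape_col j = shape_col i -> shape_row (s j) = shape_row j ->
    shape_row i <> shape_row j -> shape_row (s i) <> shape_row j.
  move=> cij sj nij sij; apply: nij; have : s i = s j by apply: pos_inj; rewrite ?cs ?sj.
  by move/perm_inj ->.
have row1 (i : 'I_d) : shape_row i = 1%N -> shape_row (s i) = 1%N.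
  move=> ri; have [t ct /(congr1 val) /=] := shape_top i; rewrite shape_wordE => rt.
  have := row_ne i t ct; rewrite row0 // rt ri => /(_ erefl).
  case: (shape_row_col (s i)) => [[-> _]|[-> //]|[rsi csi]] ne; first by case: ne.
  by have := zy i; rewrite /test_row -(cs i) csi rsi ri.
have row2 (i : 'I_d) : shape_row i = 2%N -> shape_row (s i) = 2%N.
  move=> ri; have [t ct /(congr1 val) /=] := shape_top i; rewrite shape_wordE => rt.
  have [|u cu /(congr1 val) /=] := @shape_mid i; first by apply: val_inj; rewrite /= shape_wordE ri.
  rewrite shape_wordE => ru.
  have := row_ne i t ct; rewrite row0 // rt ri => /(_ erefl).
  have := row_ne i u cu; rewrite row1 // ru ri => /(_ erefl).
  case: (shape_row_col (s i)) => [[-> _]|[-> _]|[-> //]] ne1 ne0; first by case: ne0.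
  by case: ne1.
have s1 : s = 1%g.
  apply/permP => i; rewrite perm1; apply: pos_inj => //.
  by case: (shape_row_col i) => [[ri _]|[ri _]|[ri _]]; rewrite ri;
    [apply: row0|apply: row1|apply: row2].
right; split=> //.
- by rewrite -j01 /z s1 permX1 jump01_test.
- by rewrite -j12 /z s1 permX1 jump12_test.
Qed.

(** Gelfand-Tsetlin patterns with top row [(a + m, m, 0)]: for [r = x.1], [q = x.2] and last
    component [p], the middle row is [(a + m - q, m - r)] and the bottom entry [a + m - q - p]. *)
Definition gt_index := {x : 'I_m.+1 * 'I_a.+1 & 'I_(a + x.1 - x.2).+1}.

(** The sums are kept doubled to have closed forms in [nat]; the final halving is exact by parity of
    the three factors. *)
Lemma card_gt_index : #|{: gt_index}| = nlm d l m.
Proof.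
rewrite card_tagged sumnE big_map big_enum /=.
under eq_bigr do rewrite card_ord.
rewrite -(pair_big xpredT xpredT (fun (r : 'I_m.+1) (q : 'I_a.+1) => (a + r - q).+1)) /=.
have inner (r k : nat) : (k <= a.+1)%N ->
    (2 * \sum_(q < k) (a + r - q).+1 = k * (2 * a + 2 * r + 3 - k))%N.
  elim: k => [|k IH] le_k; first by rewrite big_ord0.
  rewrite big_ord_recr /= mulnDr IH ?(ltnW le_k) //; nia.
have outer k : (2 * \sum_(r < k) \sum_(q < a.+1) (a + r - q).+1 = a.+1 * k * (a + k + 1))%N.
  elim: k => [|k IH]; first by rewrite big_ord0 !muln0.
  rewrite big_ord_recr /= mulnDr IH inner //; nia.
have := outer m.+1; rewrite /nlm => E; apply/eqP; rewrite -(eqn_pmul2l (isT : 0 < 2)%N) E.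
rewrite (_ : a + 1 = a.+1)%N ?addn1 // (_ : d - 3 * l - m + 2 = a + m.+1 + 1)%N; last by lia.
rewrite !addn1 [(2 * (_ %/ 2))%N]mulnC divnK // dvdn2 !oddM !oddS !oddD /=.
by case: (odd a); case: (odd m).
Qed.

(** The images of [hwv] under the [raise_mx], evaluated at the test words, are triangular for [q];
    on the diagonal only [s = 1] contributes, with value 1. *)
Lemma rank_hwv (C : numClosedFieldType) :
  (nlm d l m <= \rank (cyclicmx (@orbit_mx C d) (hwv C colf shape_word)))%N.
Proof.
rewrite -card_gt_index.
pose rr (x : gt_index) : nat := (tag x).1; pose qq (x : gt_index) : nat := (tag x).2.
pose pp (x : gt_index) : nat := tagged x.
have le_r x : (rr x <= m)%N by rewrite -ltnS ltn_ord.
have le_q x : (qq x <= a)%N by rewrite -ltnS ltn_ord.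
have le_p x : (pp x + qq x <= a + rr x)%N.
  have := ltn_ord (tagged x); have := le_q x; have := le_r x; rewrite /pp /qq /rr; lia.
have eqx x x' : pp x = pp x' -> qq x = qq x' -> rr x = rr x' -> x = x'.
  case: x x' => [[r q] p] [[r' q'] p'] pE qE rE.
  have {rE} rE : r = r' := val_inj rE; have {qE} qE : q = q' := val_inj qE.
  by move: p p' pE; rewrite rE qE => p p' /val_inj; rewrite /= => ->.
have uE x x' : (hwv C colf shape_word *m raise_mx C d (pp x) (qq x) (rr x)) 0
      (enum_rank (test_word (pp x') (qq x') (rr x')))
    = \sum_(s | colstab colf s) (-1) ^+ s * entX (raise_mx C d (pp x) (qq x) (rr x))
        (permX s shape_word) (test_word (pp x') (qq x') (rr x')).
  rewrite -[LHS]/(cooX _ _) cooX_mul.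
  under eq_bigr do rewrite cooX_hwv mulr_suml.
  rewrite exchange_big; apply: eq_bigr => s _ /=.
  rewrite (bigD1 (permX s shape_word)) //= eqxx mulr1 big1 ?addr0 // => z /negPf zs.
  by rewrite zs mulr0 mul0r.
apply: (triangular_rank (u := fun x => hwv C colf shape_word *m raise_mx C d (pp x) (qq x) (rr x))
  (x := fun x => enum_rank (test_word (pp x) (qq x) (rr x))) (q := qq)).
- move=> x; apply/(cyclicmxP (@SymX_orbit_mx C d) (@SymX_span C d)
    (@SymX1 C d) (@SymXD C d) (@SymXZ C d)).
  by exists (raise_mx C d (pp x) (qq x) (rr x)) => //; apply: SymX_raise_mx.
- move=> x; rewrite uE (bigD1 1%g) /=; last by apply/colstabP => i; rewrite perm1.
  rewrite big1 => [|s /andP[cs /eqP s1]]; last first.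
    have [->|/raise_triangular] := eqVneq (entX (raise_mx C d (pp x) (qq x) (rr x))
      (permX s shape_word) (test_word (pp x) (qq x) (rr x))) 0; first by rewrite mulr0.
    by case/(_ (le_r x) (le_q x) (le_p x) cs) => [|[]//]; rewrite ltnn.
  rewrite addr0 odd_perm1 mul1r permX1 entX_mxX pnatr_eq0 eqb0 negbK.
  rewrite jump01_test // jump02_test // jump12_test // !eqxx /=.
  apply/forallP => i; rewrite shape_wordE test_wordE /test_row.
  by have := ltn_ord i; rewrite /shape_row /shape_col; do !case: ltnP => ?; lia.
move=> x x'; rewrite uE => ne0.
have [s cs ne] : exists2 s, colstab colf s & entX (raise_mx C d (pp x) (qq x) (rr x))
    (permX s shape_word) (test_word (pp x') (qq x') (rr x')) != 0.
  suff /exists_inP[s cs ne] : [exists (s | colstab colf s), entX (raise_mx C d (pp x) (qq x) (rr x))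
    (permX s shape_word) (test_word (pp x') (qq x') (rr x')) != 0] by exists s.
  apply: contraNT ne0 => /exists_inPn all0; rewrite big1 // => s cs.
  by have := all0 s cs; rewrite negbK => /eqP->; rewrite mulr0.
case: (raise_triangular (le_r x') (le_q x') (le_p x') cs ne) => [|[_ pE qE rE]]; first by right.
by left; apply: eqx.
Qed.

End HookShape.

(** * Counting, and the decomposition *)

Lemma nlm_double d l m : (3 * l + 2 * m <= d)%N ->
  (2 * nlm d l m = (d - 3 * l - 2 * m + 1) * (m + 1) * (d - 3 * l - m + 2))%N.
Proof.
move=> le_lm; rewrite /nlm mulnC divnK //.
have -> : (d - 3 * l - m + 2 = (d - 3 * l - 2 * m) + m + 2)%N by lia.
by rewrite dvdn2 !oddM !oddD /=; case: (odd _); case: (odd m).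
Qed.

Lemma nlm_shift d l m : nlm d l m = nlm (d - 3 * l) 0 m.
Proof. by rewrite /nlm muln0 subn0. Qed.

(* The sum of [nlm e 0 m ^ 2] over [m < b], expanded by Faulhaber's formulas. *)
Definition block_poly (e b : rat) : rat :=
  (70 * e ^+ 4 * b ^+ 3 + 105 * e ^+ 4 * b ^+ 2 + 35 * e ^+ 4 * b - 315 * e ^+ 3 * b ^+ 4
   + 210 * e ^+ 3 * b ^+ 3 + 945 * e ^+ 3 * b ^+ 2 + 420 * e ^+ 3 * b + 546 * e ^+ 2 * b ^+ 5
   - 1470 * e ^+ 2 * b ^+ 4 - 980 * e ^+ 2 * b ^+ 3 + 2835 * e ^+ 2 * b ^+ 2
   + 1799 * e ^+ 2 * b - 420 * e * b ^+ 6 + 2016 * e * b ^+ 5 - 1365 * e * b ^+ 4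
   - 3990 * e * b ^+ 3 + 3045 * e * b ^+ 2 + 3234 * e * b + 120 * b ^+ 7 - 840 * b ^+ 6
   + 1554 * b ^+ 5 + 630 * b ^+ 4 - 3290 * b ^+ 3 + 630 * b ^+ 2 + 2036 * b) / 840.

(** The bound on [b] keeps the subtractions in [nlm e 0 m] from truncating for [m < b]. *)
Lemma sum_nlm_poly e b : (2 * b <= e + 2)%N ->
  (\sum_(m < b) nlm e 0 m ^ 2)%:R = block_poly e%:R b%:R.
Proof.
elim: b => [|b IH] le_be; first by rewrite big_ord0 /block_poly /=; field.
rewrite big_ord_recr natrD IH /=; last by lia.
have nE : (nlm e 0 b)%:R = (e%:R - 2 * b%:R + 1) * (b%:R + 1) * (e%:R - b%:R + 2) / 2 :> rat.
  have := @nlm_double e 0 b; rewrite muln0 subn0 add0n => /(_ ltac:(lia)).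
  move=> /(congr1 (fun n => n%:R : rat)).
  rewrite !natrM !natrD !natrB ?natrM; try by lia.
  by move=> <-; field.
rewrite natrX nE.
by rewrite -natr1 /block_poly; field.
Qed.

Definition bin8_poly (x : rat) : rat :=
  (x + 8) * (x + 7) * (x + 6) * (x + 5) * (x + 4) * (x + 3) * (x + 2) * (x + 1)
  / (8 * 7 * 6 * 5 * 4 * 3 * 2).

Lemma bin8E n : ('C(n + 8, 8))%:R = bin8_poly n%:R.
Proof.
have := bin_ffact (n + 8) 8; rewrite !addnS addn0 !ffactnS ffactn0 !factS fact0 /=.
move=> /(congr1 (fun n => n%:R : rat)); rewrite !natrM -!natr1 => E.
by rewrite /bin8_poly; lra.
Qed.

(** For [n < 3] the binomial vanishes and [n - 3] is a root of [bin8_poly]. *)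
Lemma bin8E' n : ('C(n + 5, 8))%:R = bin8_poly (n%:R - 3).
Proof.
case: n => [|[|[|n]]]; do ?[by rewrite bin_small // /bin8_poly; field].
rewrite (_ : n.+3 + 5 = n + 8)%N ?bin8E; last by lia.
by congr bin8_poly; rewrite -!natr1; ring.
Qed.

(** The contribution of a single [l], with [e = d - 3 l]. Splitting [e] as [2 k] or [2 k + 1] leaves
    a polynomial identity in [k]. *)
Lemma sum_nlm e :
  (\sum_(m < (e %/ 2).+1) nlm e 0 m ^ 2 + 'C(e + 5, 8) = 'C(e + 8, 8))%N.
Proof.
apply/eqP; rewrite -(eqr_nat rat) natrD sum_nlm_poly; last by lia.
rewrite bin8E bin8E' -natr1.
have : e%:R = 2 * (e %/ 2)%:R + (odd e)%:R :> rat.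
  by rewrite -natrM -natrD; congr _%:R; rewrite divn2; lia.
move: (e %/ 2)%N => k ->; apply/eqP; rewrite /block_poly /bin8_poly.
by case: (odd e) => /=; field.
Qed.

(** The sum telescopes: by [nlm_shift], the blocks with [l > 0] for [d] are the blocks for [d - 3],
    and [sum_nlm] gives those with [l = 0]. *)
Lemma sum_nlm_blocks d :
  (\sum_(l < (d %/ 3).+1) \sum_(m < ((d - 3 * l) %/ 2).+1) nlm d l m ^ 2 = 'C(d + 8, 8))%N.
Proof.
have [n lt_dn] := ubnP d; elim: n d lt_dn => // n IH d lt_dn.
have sumE e : (\sum_(m < (e %/ 2).+1) nlm e 0 m ^ 2 = 'C(e + 8, 8) - 'C(e + 5, 8))%N.
  by rewrite -sum_nlm addnK.
rewrite big_ord_recl /= muln0 subn0 sumE.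
have [lt_d3|le_3d] := ltnP d 3.
  by rewrite divn_small // big_ord0 addn0 [X in (_ - X)%N]bin_small ?subn0; lia.
rewrite (_ : d %/ 3 = ((d - 3) %/ 3).+1)%N; last by lia.
have := IH (d - 3)%N; rewrite (_ : d - 3 + 8 = d + 5)%N; last by lia.
rewrite (eq_bigr (fun l : 'I_((d - 3) %/ 3).+1 =>
    \sum_(m < ((d - 3 - 3 * l) %/ 2).+1) nlm (d - 3) l m ^ 2))%N => [->|l _]; try by lia.
  by rewrite subnK // leq_bin2l; lia.
have dE : (d - 3 * bump 0 l = d - 3 - 3 * l)%N by rewrite /bump /=; lia.
by rewrite dE; apply: eq_bigr => m _; rewrite nlm_shift dE -nlm_shift.
Qed.

Section Blocks.
Variables (C : numClosedFieldType) (d : nat).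

(** A [finType] copy of [Idx d], over which block sizes can be summed. *)
Definition block_index := {l : 'I_(d %/ 3).+1 & 'I_((d - 3 * l) %/ 2).+1}.

Definition block_size (x : block_index) : nat := nlm d (tag x) (tagged x).

Lemma block_index_leq (x : block_index) : (3 * tag x + 2 * tagged x <= d)%N.
Proof. by have := ltn_ord (tag x); have := ltn_ord (tagged x); lia. Qed.

Definition block_of (i : Idx d) : block_index :=
  Tagged (fun l : 'I_(d %/ 3).+1 => 'I_((d - 3 * l) %/ 2).+1)
    (i := Ordinal (proj1 (andP (valP i)) : (_ < (d %/ 3).+1)%N))
    (Ordinal (proj2 (andP (valP i)) : (_ < ((d - 3 * (sval i).1) %/ 2).+1)%N)).

Lemma Idx_ofP (x : block_index) :
  (((tag x : nat), (tagged x : nat)).1 <= d %/ 3)%N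
  && (((tag x : nat), (tagged x : nat)).2 <= (d - 3 * ((tag x : nat), (tagged x : nat)).1) %/ 2)%N.
Proof. by rewrite /= -ltnS ltn_ord -ltnS ltn_ord. Qed.

Definition Idx_of (x : block_index) : Idx d :=
  exist _ ((tag x : nat), (tagged x : nat)) (Idx_ofP x).

Lemma Idx_ofK : cancel Idx_of block_of.
Proof.
case=> [[l lt_l] [m lt_m]]; rewrite /block_of /=.
move: (proj1 _) (proj2 _) => /= h1 h2.
by rewrite (bool_irrelevance h1 lt_l) (bool_irrelevance h2 lt_m).
Qed.

Lemma iso_to_blocks_Idx n (S : 'M[C]_n -> Prop) :
  iso_to_blocks S block_size -> iso_to_blocks S (@nIdx d).
Proof.
case=> f [fD [fZ [fM [f1 [f_inj f_surj]]]]].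
exists (fun i => f (block_of i)); split; [|split; [|split; [|split; [|split]]]].
- by move=> i; exact: (fD (block_of i)).
- by move=> i; exact: (fZ (block_of i)).
- by move=> i; exact: (fM (block_of i)).
- by move=> i; exact: (f1 (block_of i)).
- by move=> M N SM SN fMN; apply: f_inj => // x; rewrite -(Idx_ofK x); exact: (fMN (Idx_of x)).
move=> B; have [M SM ME] := f_surj (fun x => B (Idx_of x)).
exists M => // i; rewrite ME.
case: i => [[l m] h]; rewrite /Idx_of; move: (Idx_ofP _) => /= h'.
by rewrite (bool_irrelevance h' h).
Qed.

Lemma iso_to_blocks_eq n (S S' : 'M[C]_n -> Prop) (I : Type) (k : I -> nat) :
  (forall M, S M <-> S' M) -> iso_to_blocks S k -> iso_to_blocks S' k.
Proof.
move=> eqS [f [fD [fZ [fM [f1 [f_inj f_surj]]]]]].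
exists f; split; [|split; [|split; [|split; [|split]]]] => //.
- by move=> i M N /eqS SM /eqS SN; apply: fD.
- by move=> i c M /eqS SM; apply: fZ.
- by move=> i M N /eqS SM /eqS SN; apply: fM.
- by move=> M N /eqS SM /eqS SN; apply: f_inj.
by move=> B; have [M /eqS SM ME] := f_surj B; exists M.
Qed.

(** The first two inequalities make the difference of the counts of 0 and 2 at least as large for
    [x'], the third at most as large; so all are equalities, and the counts determine the pair. *)
Lemma block_key (x x' : block_index) :
  (d - 2 * tag x - tagged x <= d - 2 * tag x' - tagged x')%N ->
  (tag x' <= tag x)%N ->
  ((d - 2 * tag x' - tagged x') - tag x' <= (d - 2 * tag x - tagged x) - tag x)%N ->
  x = x'.
Proof.
have := block_index_leq x; have := block_index_leq x'.
move=> le_x' le_x le0 le2 key; rewrite -(Idx_ofK x) -(Idx_ofK x'); congr block_of.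
by apply: val_inj => /=; congr pair; lia.
Qed.

Lemma SymX_blocks : iso_to_blocks (@SymX C d) block_size.
Proof.
pose colf (x : block_index) := fun i : 'I_d => shape_col d (tag x) (tagged x) i.
pose z0 (x : block_index) := shape_word d (tag x) (tagged x).
(* Strictly increasing in dominance order, where a larger weight has no fewer 0s and no more 2s. *)
pose key (x : block_index) := (cnt 0%R (z0 x) - cnt 2%R (z0 x))%N.
have inj0 x := shape_inj (block_index_leq x).
have top0 x := shape_top (block_index_leq x).
have mid0 x := shape_mid (block_index_leq x).
apply: (@iso_blocks_highest_weight C _ (@SymX C d) _ (@orbit_mx C d) (@SymX_orbit_mx C d)
  (@SymX_span C d) (@SymX1 C d) (@SymXD C d) (@SymXZ C d) (@SymX_mul C d) _
  (fun x => hwv C (colf x) (z0 x)) (fun x => hwE C (z0 x)) (fun x => enum_rank (z0 x)) key).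
- by move=> x; apply: SymX_Estar.
- by move=> x M SM; apply: hwv_line; [apply: inj0|apply: top0|apply: mid0|].
- move=> x x' M SM xx' le_key; apply: cooX_inj => y; rewrite [RHS]mxE cooX_Estar.
  have [->|/(hwv_mul_col_inj SM) yI] := eqVneq (cooX (hwv C (colf x') (z0 x') *m M) y) 0.
    by rewrite mul0r.
  case: andP => [[/eqP c1 /eqP c2]|_]; last by rewrite mulr0.
  have le0 := col_inj_cnt0 (@top0 x') yI.
  have le2 := col_inj_cnt2 (@inj0 x') (@top0 x') (@mid0 x') yI.
  case/eqP: xx'; apply/esym; move: le_key le0 le2; rewrite /key (cnt0_eq c1 c2) c2 /z0.
  rewrite !shape_cnt0 ?shape_cnt2 ?block_index_leq // => le_key le0 le2.
  exact: block_key.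
- by move=> x M SM; apply: hwv_nondeg; [apply: inj0|apply: top0|apply: mid0|].
- by move=> x; apply: rank_hwv; apply: block_index_leq.
rewrite card_pair_type -sum_nlm_blocks.
pose F (l : 'I_(d %/ 3).+1) (m : 'I_((d - 3 * l) %/ 2).+1) := (nlm d l m ^ 2)%N.
exact/esym/(sig_big_dep xpredT (fun _ => xpredT) F).
Qed.

End Blocks.

Theorem theorem1p4 (C : numClosedFieldType) (d : nat) (hd : (0 < d)%N) :
  (forall M : MatX C d, @Terwilliger C d M <-> @SymX C d M) /\
  @iso_to_blocks C _ (@Terwilliger C d) (Idx d) (@nIdx d) /\
  @iso_to_blocks C _ (@SymX C d) (Idx d) (@nIdx d).
Proof.
have TS (M : MatX C d) : Terwilliger M <-> SymX M.
  by split; [apply: Terwilliger_SymX | apply: SymX_Terwilliger].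
have iso := iso_to_blocks_Idx (@SymX_blocks C d).
by split=> //; split=> //; apply: iso_to_blocks_eq iso => M; split => /TS.
Qed.
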